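(* Let $n,m\ge 1$ and let $P(x,y)$ be an $n$-vector of polynomials of degree at most $2$ with nonnegative coefficients in the variables $x=(x_1,\dots,x_n)$ and $y=(y_1,\dots,y_m)$. Let $y_1,y_2\in\mathbb{R}^m$ with $0<y_1\le\mathbf{1}$ and $0\le y_2\le y_1$, and set $P_1(x)\equiv P(x,y_1)$, $P_2(x)\equiv P(x,y_2)$. Suppose $x=P_1(x)$ is a strongly connected MPS with least fixed point $q^*_1$ satisfying $0<q^*_1\le \mathbf{1}$. Let $\alpha=\min\{1,c_{\min}\}\cdot\min\{y_{\min},\tfrac12 q^*_{\min}\}$, where $c_{\min}$ is the smallest nonzero constant or coefficient of any monomial in $P(x,y)$, $y_{\min}$ is the minimum coordinate of $y_1$, and $q^*_{\min}$ is the minimum coordinate of $q^*_1$. Then: 1. The MPS $x=P_2(x)$ has a least fixed point $q^*_2$ with $0\le q^*_2\le q^*_1$, and $$\|q^*_1-q^*_2\|_\infty\le\sqrt{4n\,\alpha^{-(3n+1)}\,\|P(\mathbf{1},\mathbf{1})\|_\infty\,\|y_1-y_2\|_\infty}.$$ Furthermore, if $x=P_1(x)$ is a linear system, then $\|q^*_1-q^*_2\|_\infty\le 2n\,\alpha^{-(n+2)}\|P(\mathbf{1},\mathbf{1})\|_\infty\|y_1-y_2\|_\infty$. 2. For every $0<\epsilon<1$, if one performs $g\ge h-1$ iterations of the rounded-down Newton's method with integer rounding parameter $h\ge\lceil 2+n\log\frac1\alpha+\log\frac1\epsilon\rceil$ on the MPS $x=P_2(x)$, starting at $x^{[0]}=\mathbf{0}$,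 then all iterations are defined and $\|q^*_2-x^{[g]}\|_\infty\le\epsilon$.
   Context: An MPS is a system $x=P(x)$ where each coordinate polynomial has nonnegative coefficients and constant term; its least fixed point (LFP) is the coordinatewise least nonnegative solution. The dependency graph of an MPS has the variables as nodes and an edge $x_i\to x_j$ iff $x_j$ appears in a monomial of $P_i$ with positive coefficient; the MPS is strongly connected if this graph is strongly connected. $B(x)$ denotes the Jacobian matrix of $P(x)$, $B(x)_{ij}=\partial P_i/\partial x_j$. The Newton operator is $\mathcal{N}_P(z)=z+(I-B(z))^{-1}(P(z)-z)$ (defined when $I-B(z)$ is nonsingular). Rounded-down Newton's method (R-NM) with integer parameter $h>0$: $x^{[0]}=\mathbf{0}$, and for $k\ge0$, compute $x^{\{k+1\}}=\mathcal{N}_P(x^{[k]})$ and set each $x^{[k+1]}_i$ to the largest nonnegative integer multiple of $2^{-h}$ that is $\le\max(x^{\{k+1\}}_i,0)$. ''Linear system'' means all polynomials of $P_1$ have degree at most $1$ in $x$. Logarithms are base 2; $\mathbf{1}$ is the all-ones vector. *)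

(* Defs.v *)
From HB Require Import structures.
From mathcomp Require Import all_boot all_order all_algebra.
From mathcomp Require Import reals.
(* Required but not imported: notations clash with those of mpoly. *)
From mathcomp Require exp matrix_normedtype.
From mathcomp Require Import mpoly.

Set Implicit Arguments.
Unset Strict Implicit.
Unset Printing Implicit Defensive.

Import Order.TTheory GRing.Theory Num.Theory.
Local Open Scope ring_scope.

Definition log2 (R : realType) (x : R) : R := exp.ln x / exp.ln 2.

Definition norm_inf (R : realType) n (v : 'cV[R]_n) : R :=
  matrix_normedtype.mx_norm v.

Definition vle (R : realType) n (u v : 'cV[R]_n) : Prop :=
  forall i, u i 0 <= v i 0.

Definition vlt (R : realType) n (u v : 'cV[R]_n) : Prop :=
  forall i, u i 0 < v i 0.

Definition ones (R : realType) n : 'cV[R]_n := const_mx 1.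

(* Only meaningful on nonempty sequences, see seq_minP. *)
Definition seq_min (R : realType) (s : seq R) : R :=
  \big[Num.min/head 0 s]_(a <- s) a.

Lemma seq_minP (R : realType) (s : seq R) : s != [::] ->
  seq_min s \in s /\ (forall a, a \in s -> seq_min s <= a).
Proof.
case: s => // a0 s _; rewrite /seq_min /=; split; last first.
  by move=> a a_in; apply: (ge_bigmin_seq _ a predT id).
rewrite big_seq; elim/big_ind: _ => [|x y xs ys|//]; first exact: mem_head.
by rewrite minElt; case: ifP.
Qed.

Definition vec_min (R : realType) n (v : 'cV[R]_n) : R :=
  seq_min [seq v i 0 | i <- enum 'I_n].

Section PolynomialVectors.
Variables (R : realType) (n k : nat).
Implicit Type P : 'I_n -> {mpoly R[k]}.

Definition nonneg_coeffs P : Prop := forall i (mu : 'X_{1..k}), 0 <= (P i)@_mu.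

Definition degree_le P (d : nat) : Prop := forall i, (msize (P i) <= d.+1)%N.

Definition pvec_eval P (z : 'cV[R]_k) : 'cV[R]_n :=
  \col_i (P i).@[fun j => z j 0].

(* msupp lists exactly the monomials with nonzero coefficient (the constant
   term corresponding to the monomial 0). *)
Definition coeff_min P : R :=
  seq_min (flatten [seq [seq (P i)@_mu | mu <- msupp (P i)] | i <- enum 'I_n]).

End PolynomialVectors.

(* Substitutes the real vector y for the last m variables. *)
Definition instantiate (R : realType) (n m : nat)
    (P : 'I_n -> {mpoly R[n + m]}) (y : 'cV[R]_m) : 'I_n -> {mpoly R[n]} :=
  fun i => P i \mPo [tuple match split l with
                           | inl j => 'X_j
                           | inr j => (y j 0)%:MP
                           end | l < n + m].

Section MPS.
Variables (R : realType) (n : nat).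
Implicit Type P : 'I_n -> {mpoly R[n]}.

Definition is_mps P : Prop := nonneg_coeffs P.

Definition is_lfp P (q : 'cV[R]_n) : Prop :=
  [/\ vle 0 q, q = pvec_eval P q &
      forall q', vle 0 q' -> q' = pvec_eval P q' -> vle q q'].

Definition dependency P : rel 'I_n :=
  [rel i j | has (fun mu : 'X_{1..n} => (0 < (P i)@_mu) && (0 < mu j)%N)
                 (msupp (P i))].

Definition strongly_connected P : Prop :=
  forall i j, connect (dependency P) i j.

Definition jacobian P (z : 'cV[R]_n) : 'M[R]_n :=
  \matrix_(i, j) ((P i)^`M(j)).@[fun l => z l 0].

Definition newton P (z : 'cV[R]_n) : option 'cV[R]_n :=
  let A := 1%:M - jacobian P z in
  if A \in unitmx then Some (z + invmx A *m (pvec_eval P z - z)) else None.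

Definition round_down (h : nat) (a : R) : R :=
  (Num.truncn (Num.max a 0 * 2 ^+ h))%:R / 2 ^+ h.

(* The value is None as soon as one of the Newton steps is undefined. *)
Fixpoint rnm P (h g : nat) : option 'cV[R]_n :=
  if g is g'.+1 then
    obind (fun x => omap (map_mx (round_down h)) (newton P x)) (rnm P h g')
  else Some 0.

End MPS.

Lemma round_downP (R : realType) (h : nat) (a : R) :
  [/\ exists N : nat, round_down h a = N%:R / 2 ^+ h,
      round_down h a <= Num.max a 0 &
      forall N : nat, N%:R / 2 ^+ h <= Num.max a 0 ->
        N%:R / 2 ^+ h <= round_down h a].
Proof.
have h0 : 0 < (2 : R) ^+ h by rewrite exprn_gt0.
have a0 : 0 <= Num.max a 0 * 2 ^+ h.
  by rewrite mulr_ge0 ?(ltW h0)// le_max lexx orbT.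
split; first by eexists; reflexivity.
  by rewrite /round_down ler_pdivrMr// Num.Theory.truncn_le.
move=> N; rewrite ler_pdivrMr// => leN.
by rewrite /round_down ler_pM2r ?invr_gt0// ler_nat Num.Theory.truncn_ge_nat.
Qed.

Definition alpha (R : realType) (n m : nat) (P : 'I_n -> {mpoly R[n + m]})
    (y1 : 'cV[R]_m) (q1 : 'cV[R]_n) : R :=
  Num.min 1 (coeff_min P) * Num.min (vec_min y1) (2^-1 * vec_min q1).

(* Main.v *)
Require Import Defs.
From mathcomp Require Import all_boot all_order all_algebra.
From mathcomp Require Import reals mpoly.
From mathcomp Require Import ring lra zify.
Import Order.TTheory GRing.Theory Num.Theory.
Local Open Scope ring_scope.

Set Implicit Arguments.
Unset Strict Implicit.
Unset Printing Implicit Defensive.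

(* Write B1 for the Jacobian of P1. No v >= 0 satisfies B1(q1) v > v: otherwise
   q1 - e v would be a post-fixed point of P1 below q1 for small e. By Ville's
   theorem of the alternative B1(q1) then has a left cone vector u, i.e. u >= 0,
   u <> 0 and u B1(q1) <= u, and, by the same theorem applied to the transpose,
   a right cone vector w. Every edge of the dependency graph contributes at
   least alpha to the Jacobian already at q1 / 2, so strong connectivity bounds
   the ratio of any two entries of a cone vector by alpha ^ (n - 1).

   The gap d = q1 - q2 satisfies d = B1((q1 + q2) / 2) d + e with
   e = P(q2, y1) - P(q2, y2), hence its entries have the same bounded ratios.
   Pairing with u leaves u Q(d) <= u e for the quadratic part Q of P1, which
   bounds |d|^2 when Q <> 0; when Q = 0 one bounds the inverse of I - B1 using
   (I - B1) q1 = P1(0).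

   For Newton's method on P2, q2 - x <= lam w implies q2 - N(x) <= (lam / 2) w
   whenever I - B2(x) has a nonnegative inverse. That inverse exists as long as
   x < q1 strictly (if P1 is not linear), and this strict inequality is an
   invariant of the rounded iteration. *)

(** * Theorem of the alternative *)

Section Alternative.
Variable R : realFieldType.

Lemma gt_below_seq (l : R) (hi : seq R) :
  (forall h, h \in hi -> l < h) ->
  exists2 s, l < s & forall h, h \in hi -> s < h.
Proof.
elim: hi => [_|h hi IH lt_hi]; first by exists (l + 1); [lra|].
have [|s ls s_hi] := IH; first by move=> k k_hi; rewrite lt_hi // inE k_hi orbT.
have lh : l < h by rewrite lt_hi ?mem_head.
exists (Num.min s ((l + h) / 2)) => [|k].
  by rewrite lt_min ls /=; lra.
rewrite inE gt_min => /orP[/eqP->|/s_hi->//].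
by apply/orP; right; lra.
Qed.

(** The one-variable case of the elimination below. Each lower bound is absorbed by raising [l0],
    which will be 0 and so forces a positive value. *)
Lemma between_seqs (l0 : R) (lo hi : seq R) :
  (forall h, h \in hi -> l0 < h) ->
  (forall l h, l \in lo -> h \in hi -> l < h) ->
  exists s, [/\ l0 < s, forall l, l \in lo -> l < s &
                forall h, h \in hi -> s < h].
Proof.
elim: lo l0 => [|l lo IH] l0 l0_hi lo_hi.
  by have [s l0s s_hi] := gt_below_seq l0_hi; exists s.
have [|k h k_lo|s [ls s_lo s_hi]] := IH (Num.max l0 l).
- by move=> h h_hi; rewrite gt_max l0_hi //= lo_hi ?mem_head.
- by apply: lo_hi; rewrite inE k_lo orbT.
move: ls; rewrite gt_max => /andP[l0s ls].
by exists s; split=> // k; rewrite inE => /orP[/eqP->//|/s_lo].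
Qed.

(** Only nontrivial combinations are generated: the scalars are strictly positive and there is no
    constructor for zero. This is what later makes the multipliers of a certificate nonzero. *)
Inductive cone n (S : seq 'rV[R]_n) : 'rV[R]_n -> Prop :=
| cone_mem r of r \in S : cone S r
| cone_add r s of cone S r & cone S s : cone S (r + s)
| cone_scale a r of 0 < a & cone S r : cone S (a *: r).

Lemma cone_sub n (S S' : seq 'rV[R]_n) r :
  (forall s, s \in S' -> cone S s) -> cone S' r -> cone S r.
Proof.
move=> sub; elim=> [s /sub //|s t _ Ss _ St|b s b0 _ Ss].
  exact: cone_add.
exact: cone_scale.
Qed.

(** Fourier-Motzkin elimination, one coordinate [j0] at a time. A solution of the reduced system
    [S'] extends to [j0], and a certificate for [S'] is already one for [S]. *)
Lemma fourier_motzkin n (s : seq 'I_n) (S : seq 'rV[R]_n) : uniq s ->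
  (exists2 v : 'I_n -> R, forall j, 0 <= v j &
     forall r, r \in S -> \sum_(j <- s) r 0 j * v j < 0) \/
  (exists2 r, cone S r & forall j, j \in s -> 0 <= r 0 j).
Proof.
elim: s S => [|j0 s IH] S.
  move=> _; case: S => [|r S]; first by left; exists (fun=> 0).
  by right; exists r => //; apply: cone_mem; rewrite mem_head.
move=> /= /andP[j0s us].
(* The sign constraint on [v j0] acts like one more row with a negative coefficient at [j0].
   Combining it with a row of [Snn] amounts to keeping that row as it stands. *)
pose Snn := [seq r : 'rV[R]_n <- S | 0 <= r 0 j0].
pose Sp := [seq r : 'rV[R]_n <- S | 0 < r 0 j0].
pose Sn := [seq r : 'rV[R]_n <- S | r 0 j0 < 0].
pose S' := Snn ++
  [seq (r : 'rV[R]_n) 0 j0 *: t - (t : 'rV[R]_n) 0 j0 *: r | r <- Sp, t <- Sn].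
case: (IH S' us) => [[v v0 vS]|[r S'r r0]].
  left.
  pose psi (r : 'rV[R]_n) := \sum_(j <- s) r 0 j * v j.
  have psi_nn r : r \in S -> 0 <= r 0 j0 -> psi r < 0.
    by move=> rS r0; apply: vS; rewrite mem_cat mem_filter r0 rS.
  have psi_pn r t : r \in S -> t \in S -> 0 < r 0 j0 -> t 0 j0 < 0 ->
      r 0 j0 * psi t - t 0 j0 * psi r < 0.
    move=> rS tS r0 t0.
    have : r 0 j0 *: t - t 0 j0 *: r \in S'.
      rewrite mem_cat; apply/orP; right; apply/allpairsP.
      by exists (r, t); rewrite !mem_filter r0 t0 rS tS.
    move/vS; congr (_ < _); rewrite /psi !mulr_sumr -sumrB.
    by apply: eq_bigr => j _; rewrite !mxE; ring.
  (* Rows of [Sn] bound the missing coordinate from below and rows of [Sp] from above; [psi_pn] says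
     that these bounds are compatible. *)
  have [h|l h|w [w0 w_lo w_hi]] := @between_seqs 0
      [seq psi t / - (t : 'rV[R]_n) 0 j0 | t <- Sn]
      [seq - psi r / (r : 'rV[R]_n) 0 j0 | r <- Sp].
  - case/mapP=> r; rewrite mem_filter => /andP[r0 rS] ->.
    by rewrite divr_gt0 // oppr_gt0 psi_nn // ltW.
  - case/mapP=> t; rewrite mem_filter => /andP[t0 tS] ->.
    case/mapP=> r; rewrite mem_filter => /andP[r0 rS] ->.
    rewrite ltr_pdivrMr ?oppr_gt0 // mulrAC ltr_pdivlMr //.
    by have := psi_pn r t rS tS r0 t0; lra.
  exists (fun j => if j == j0 then w else v j) => [j|r rS].
    by case: ifP => // _; apply: ltW.
  rewrite big_cons eqxx.
  have -> : \sum_(j <- s) r 0 j * (if j == j0 then w else v j) = psi r.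
    apply: eq_big_seq => j js; case: eqP => // jj0.
    by rewrite jj0 (negPf j0s) in js.
  case: (ltrgtP (r 0 j0) 0) => r0.
  - have : psi r / - r 0 j0 < w by apply/w_lo/map_f; rewrite mem_filter r0 rS.
    by rewrite ltr_pdivrMr ?oppr_gt0 //; lra.
  - have : w < - psi r / r 0 j0 by apply/w_hi/map_f; rewrite mem_filter r0 rS.
    by rewrite ltr_pdivlMr //; lra.
  - by rewrite r0 mul0r add0r psi_nn // r0.
right; exists r; last first.
  move=> j; rewrite inE => /orP[/eqP->|]; last exact: r0.
  (* Every generator in [S'] is nonnegative at [j0]: either it was kept for that reason, or its
     entry there cancels. *)
  elim: S'r => [t|t u _ Ht _ Hu|b t b0 _ Ht].
  - rewrite mem_cat mem_filter => /orP[/andP[]//|].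
    by case/allpairsP=> -[x y] /= [_ _ ->]; rewrite !mxE mulrC subrr.
  - by rewrite mxE addr_ge0.
  - by rewrite mxE mulr_ge0 // ltW.
apply: cone_sub S'r => t; rewrite mem_cat mem_filter => /orP[/andP[_]|].
  exact: cone_mem.
case/allpairsP=> -[x y] /=; rewrite !mem_filter => -[/andP[x0 xS] /andP[y0 yS] ->].
rewrite -scaleNr; apply: cone_add; apply: cone_scale; rewrite ?oppr_gt0 //;
  exact: cone_mem.
Qed.

Lemma cone_rows_comb m n (A : 'M[R]_(m, n)) r :
  cone [seq row i A | i <- enum 'I_m] r ->
  exists u : 'I_m -> R, [/\ forall i, 0 <= u i, exists i, 0 < u i &
    forall j, r 0 j = \sum_i u i * A i j].
Proof.
elim=> [s /mapP[i _ ->]|s t _ [u [u0 [i ui] us]] _ [v [v0 _ vt]]|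
        b s b0 _ [u [u0 [i ui] us]]].
- exists (fun k => (k == i)%:R); split=> [k||j]; first exact: ler0n.
    by exists i; rewrite eqxx ltr01.
  rewrite mxE (bigD1 i) //= eqxx mul1r big1 ?addr0 // => k /negPf->.
  by rewrite mul0r.
- exists (fun k => u k + v k); split=> [k||j]; first exact: addr_ge0.
    by exists i; rewrite ltr_wpDr.
  by rewrite mxE us vt -big_split; apply: eq_bigr => k _; rewrite mulrDl.
- exists (fun k => b * u k); split=> [k||j]; first by rewrite mulr_ge0 // ltW.
    by exists i; rewrite mulr_gt0.
  by rewrite mxE us mulr_sumr; apply: eq_bigr => k _; rewrite mulrA.
Qed.

Lemma ville m n (A : 'M[R]_(m, n)) :
  (exists2 v : 'I_n -> R, forall j, 0 <= v j &
     forall i, \sum_j A i j * v j < 0) \/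
  (exists u : 'I_m -> R, [/\ forall i, 0 <= u i, exists i, 0 < u i &
     forall j, 0 <= \sum_i u i * A i j]).
Proof.
case: (@fourier_motzkin n (index_enum _) [seq row i A | i <- enum 'I_m]
  (index_enum_uniq _)) => [[v v0 vS]|[r /cone_rows_comb[u [u0 ui ur]] r0]].
  left; exists v => // i.
  have /vS : row i A \in [seq row i A | i <- enum 'I_m].
    by apply: map_f; rewrite mem_enum.
  by congr (_ < _); apply: eq_bigr => j _; rewrite mxE.
by right; exists u; split=> // j; rewrite -ur r0 ?mem_index_enum.
Qed.

End Alternative.

(** * Nonnegative matrices *)

Lemma connect_invariant (I : finType) (e : rel I) (Q : I -> Prop) i j :
  (forall k l, e k l -> Q k -> Q l) -> connect e i j -> Q i -> Q j.
Proof.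
move=> eQ /connectP[p pth ->] {j}; elim: p i pth => //= k p IH i.
by case/andP=> ik kp Qi; apply: IH kp _; apply: eQ ik Qi.
Qed.

Section MatrixAction.
Variables (R : realFieldType) (n : nat).
Implicit Types (B C : 'I_n -> 'I_n -> R) (x y v w d u : 'I_n -> R).

(** Vectors and matrices are plain functions, so that Jacobians at points given by explicit terms
    can be written directly; actual matrices enter by coercion. *)
Definition mv B x (i : 'I_n) : R := \sum_j B i j * x j.

Definition tr B (i j : 'I_n) : R := B j i.

Lemma mvD B x y i : mv B (fun j => x j + y j) i = mv B x i + mv B y i.
Proof. by rewrite /mv -big_split; apply: eq_bigr => j _; rewrite mulrDr. Qed.

Lemma mvB B x y i : mv B (fun j => x j - y j) i = mv B x i - mv B y i.
Proof. by rewrite /mv -sumrB; apply: eq_bigr => j _; rewrite mulrBr. Qed.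

Lemma mvZ B a x i : mv B (fun j => a * x j) i = a * mv B x i.
Proof. by rewrite /mv mulr_sumr; apply: eq_bigr => j _; rewrite mulrCA. Qed.

Lemma mv_ge0 B x i : (forall j, 0 <= B i j) -> (forall j, 0 <= x j) ->
  0 <= mv B x i.
Proof. by move=> B0 x0; apply: sumr_ge0 => j _; rewrite mulr_ge0. Qed.

Lemma le_mv B x y i : (forall j, 0 <= B i j) -> (forall j, x j <= y j) ->
  mv B x i <= mv B y i.
Proof. by move=> B0 xy; apply: ler_sum => j _; rewrite ler_wpM2l. Qed.

Lemma le_mvl B C x i : (forall j, 0 <= x j) -> (forall j, B i j <= C i j) ->
  mv B x i <= mv C x i.
Proof. by move=> x0 BC; apply: ler_sum => j _; rewrite ler_wpM2r. Qed.

Lemma mv_ge_term B x i j : (forall k, 0 <= B i k) -> (forall k, 0 <= x k) ->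
  B i j * x j <= mv B x i.
Proof.
move=> B0 x0; rewrite /mv (bigD1 j) //= lerDl.
by apply: sumr_ge0 => k _; rewrite mulr_ge0.
Qed.

Lemma sum_mv_tr B u x : \sum_i u i * mv B x i = \sum_j mv (tr B) u j * x j.
Proof.
rewrite /mv; under eq_bigr do rewrite mulr_sumr.
rewrite exchange_big; apply: eq_bigr => j _; rewrite mulr_suml.
by apply: eq_bigr => i _; rewrite /tr mulrA [u i * _]mulrC.
Qed.

(** The alternative is applied to I - B, whose first branch is precisely a strictly expanding
    vector. *)
Lemma exists_left_cone B :
  ~ (exists2 v, forall j, 0 <= v j & forall i, v i < mv B v i) ->
  exists u, [/\ forall i, 0 <= u i, exists i, 0 < u i &
                forall j, mv (tr B) u j <= u j].
Proof.
move=> noexp; have E (f : 'I_n -> R) i : \sum_j (i == j)%:R * f j = f i.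
  rewrite (bigD1 i) //= eqxx mul1r big1 ?addr0 // => j.
  by rewrite eq_sym => /negPf->; rewrite mul0r.
case: (ville (\matrix_(i, j) ((i == j)%:R - B i j))) => [[v v0 vB]|[u [u0 ui uB]]].
  case: noexp; exists v => // i; rewrite -subr_lt0; have := vB i.
  congr (_ < _); rewrite -[v i in RHS](E v) /mv -sumrB.
  by apply: eq_bigr => j _; rewrite mxE mulrBl.
exists u; split=> // j; rewrite -subr_ge0; have := uB j.
congr (_ <= _); rewrite -[u j in RHS](E u) /mv -sumrB.
by apply: eq_bigr => i _; rewrite mxE /tr eq_sym; ring.
Qed.

(* A strictly expanding [v] for the transpose is excluded at an index where
   the ratio [v i / u i] is maximal. *)
Lemma exists_right_cone (B : 'I_n -> 'I_n -> R) (u : 'I_n -> R) (i0 : 'I_n) :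
  (forall i j, 0 <= B i j) -> (forall i, 0 < u i) ->
  (forall j, mv (tr B) u j <= u j) ->
  exists d, [/\ forall i, 0 <= d i, exists i, 0 < d i &
                forall i, mv B d i <= d i].
Proof.
move=> B0 u0 uB; apply: (@exists_left_cone (tr B)) => -[v v0 vB].
pose i := [arg max_(k > i0) (v k / u k)]%O.
have imax k : v k <= v i / u i * u k.
  rewrite /i; case: (@Order.TotalTheory.arg_maxP _ _ _ i0 predT) => // l _ lmax.
  by rewrite -ler_pdivrMr //; apply: lmax.
have /lt_le_trans := vB i; have le1 : mv (tr B) v i <= v i.
  apply: (@le_trans _ _ (mv (tr B) (fun k => v i / u i * u k) i)).
    by apply: le_mv => // k; apply: B0.
  rewrite mvZ -[leRHS](@divfK _ (u i)) ?gt_eqF //.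
  by rewrite ler_wpM2l // divr_ge0 // ltW.
by move/(_ _ le1); rewrite ltxx.
Qed.

Section Irreducible.
Variables (E : rel 'I_n) (E_conn : forall i j, connect E i j).

(** Each edge of a path costs a factor [a]. A path without repeated vertices has at most n - 1
    edges, and [a <= 1] allows rounding its length up to that. *)
Lemma connected_ratio (a : R) w i j : 0 <= a <= 1 -> (forall i, 0 <= w i) ->
  (forall i j, E i j -> a * w j <= w i) -> a ^+ n.-1 * w j <= w i.
Proof.
move=> /andP[a0 a1] w0 Ew.
have /connectP[p0 pth0 ->] := E_conn i j.
case: (shortenP pth0) => p pth up _ {p0 pth0}.
have szp : (size p <= n.-1)%N.
  have := max_card (mem (i :: p)); rewrite (card_uniqP up) card_ord /=.
  by rewrite -[(size p <= _)%N]ltnS prednK // (leq_ltn_trans _ (ltn_ord i)).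
apply: (@le_trans _ _ (a ^+ size p * w (last i p))).
  by rewrite ler_wpM2r // ler_wiXn2l.
elim: p i pth {up szp} => [|k p IH] i /=; first by rewrite expr0 mul1r.
case/andP=> ik /IH le1; apply: le_trans (Ew _ _ ik).
by rewrite exprS -mulrA ler_wpM2l.
Qed.

(* At a minimal ratio [y i / d i < 0] all the inequalities are equalities, so
   the row of [C] is the row of [B] and minimality spreads along the edges. *)
Lemma subcone_monotone B C d y k0 :
  (forall i j, 0 <= C i j <= B i j) -> (forall i j, E i j -> 0 < B i j) ->
  (forall i, 0 < d i) -> (forall i, mv B d i <= d i) -> mv C d k0 < d k0 ->
  (forall i, mv C y i <= y i) -> forall i, 0 <= y i.
Proof.
move=> CB EB d0 Bd Cd0 Cy.
have C0 i j : 0 <= C i j by case/andP: (CB i j).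
have CleB i j : C i j <= B i j by case/andP: (CB i j).
pose i1 := [arg min_(k < k0) (y k / d k)]%O; set s := y i1 / d i1.
have smin k : s * d k <= y k.
  rewrite /s /i1; case: (@Order.TotalTheory.arg_minP _ _ _ k0 predT) => // l _ lmin.
  by rewrite -ler_pdivlMr //; apply: lmin.
case: (lerP 0 s) => s0.
  by move=> i; apply: le_trans (smin i); rewrite mulr_ge0 // ltW.
exfalso.
have key i : y i = s * d i -> mv C d i = d i /\ (forall j, E i j -> y j = s * d j).
  move=> yi.
  have h1 : s * mv C d i <= mv C y i by rewrite -mvZ; apply: le_mv.
  have h2 := Cy i.
  have h3 : mv C d i <= mv B d i by apply: le_mvl => // j; apply: ltW.
  have h4 := Bd i.
  have h5 : d i <= mv C d i by rewrite -(ler_nM2l s0) -yi; apply: le_trans h2.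
  have e1 : mv C d i = d i by apply/eqP; rewrite eq_le h5 (le_trans h3).
  split=> // j Eij.
  have e2 : \sum_k (B i k - C i k) * d k = 0.
    have -> : \sum_k (B i k - C i k) * d k = mv B d i - mv C d i.
      by rewrite /mv -sumrB; apply: eq_bigr => k _; rewrite mulrBl.
    by lra.
  have e3 : \sum_k C i k * (y k - s * d k) = 0.
    have -> : \sum_k C i k * (y k - s * d k) = mv C y i - s * mv C d i.
      by rewrite -mvZ -mvB.
    apply/eqP; rewrite eq_le subr_ge0 h1 andbT subr_le0 e1 -yi.
    exact: h2.
  have BC : B i j = C i j.
    have /psumr_eq0P : forall k, true -> 0 <= (B i k - C i k) * d k.
      by move=> k _; rewrite mulr_ge0 ?subr_ge0 // ltW.
    move/(_ e2 j isT)/eqP; rewrite mulf_eq0 (gt_eqF (d0 j)) orbF subr_eq0.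
    by move/eqP.
  have /psumr_eq0P : forall k, true -> 0 <= C i k * (y k - s * d k).
    by move=> k _; rewrite mulr_ge0 ?subr_ge0.
  move/(_ e3 j isT)/eqP; rewrite mulf_eq0 -BC gt_eqF ?EB //= subr_eq0.
  by move/eqP.
(* Connectivity carries the equality from the minimizer [i1] to [k0], where [key] contradicts the
   strict inequality assumed for [C]. *)
have : y k0 = s * d k0.
  apply: (@connect_invariant _ E (fun i => y i = s * d i) i1 k0) => //.
    by move=> i j ij /key[_]; apply.
  by rewrite /s divfK // gt_eqF.
by move/key=> [e _]; rewrite e ltxx in Cd0.
Qed.

End Irreducible.

(** Inverse monotonicity of I - B. It amounts to I - B having a nonnegative inverse, but in this
    form it serves directly as a comparison principle. *)
Definition monotone_resolvent B : Prop :=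
  forall y, (forall i, mv B y i <= y i) -> forall i, 0 <= y i.

Lemma mulmx_resolvent (B : 'M[R]_n) (z : 'cV[R]_n) i :
  ((1%:M - B) *m z) i 0 = z i 0 - mv B (fun j => z j 0) i.
Proof. by rewrite mulmxBl mul1mx mxE mxE; congr (_ - _); rewrite mxE. Qed.

(** A kernel vector and its negative both satisfy the premise of monotonicity, so both are
    nonnegative. The transpose appears because [kermx] is a left kernel. *)
Lemma monotone_resolvent_unit (B : 'M[R]_n) :
  monotone_resolvent B -> 1%:M - B \in unitmx.
Proof.
move=> Bmono; rewrite -unitmx_tr -row_free_unit -kermx_eq0; apply/rowV0P => v.
move/sub_kermxP => vB; have : (1%:M - B) *m v^T = 0.
  by rewrite -[LHS]trmxK trmx_mul trmxK vB trmx0.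
move=> Bv; have Bv0 i : v 0 i - mv B (v 0) i = 0.
  have := mulmx_resolvent B v^T i; rewrite Bv mxE mxE => ->.
  by congr (_ - _); apply: eq_bigr => j _; rewrite mxE.
apply/rowP => i; rewrite mxE; apply/eqP; rewrite eq_le.
apply/andP; split; last by apply: Bmono i => i; rewrite -subr_ge0 Bv0.
rewrite -oppr_ge0 -[- v 0 i]mulN1r.
apply: (Bmono (fun i => -1 * v 0 i)) i => i; rewrite mvZ -subr_ge0.
by have := Bv0 i; lra.
Qed.

(** Column j of the inverse is mapped by I - B to a unit vector, which is nonnegative. *)
Lemma monotone_resolvent_inv (B : 'M[R]_n) i j :
  monotone_resolvent B -> 0 <= invmx (1%:M - B) i j.
Proof.
move=> Bmono; have Bu := monotone_resolvent_unit Bmono.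
pose z := col j (invmx (1%:M - B)).
have -> : invmx (1%:M - B) i j = z i 0 by rewrite mxE.
apply: (Bmono (fun i => z i 0)) i => i.
by rewrite -subr_ge0 -mulmx_resolvent /z colE mulmxA mulmxV // mul1mx mxE ler0n.
Qed.

End MatrixAction.

(** * Quadratic maps and their least fixed points *)

(** The fixed point is the coordinatewise infimum of all nonnegative post-fixed points, a set that
    [z] makes nonempty. Hence it is least even among post-fixed points. *)
Lemma knaster_tarski (R : realType) n (F : ('I_n -> R) -> 'I_n -> R) z :
  (forall x i, (forall j, 0 <= x j) -> 0 <= F x i) ->
  (forall x y i, (forall j, 0 <= x j) -> (forall j, x j <= y j) ->
     F x i <= F y i) ->
  (forall i, 0 <= z i) -> (forall i, F z i <= z i) ->
  exists q, [/\ forall i, 0 <= q i, forall i, F q i = q i &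
    forall x, (forall i, 0 <= x i) -> (forall i, F x i <= x i) ->
      forall i, q i <= x i].
Proof.
move=> F0 Fmono z0 Fz.
pose S x := (forall i, 0 <= x i) /\ (forall i, F x i <= x i).
pose q i := inf (fun r => exists2 x, S x & r = x i).
have qS x i : S x -> q i <= x i.
  move=> Sx; apply: ge_inf; last by exists x.
  by exists 0 => _ [y [y0 _] ->].
have q_ge x : (forall y, S y -> forall i, x i <= y i) -> forall i, x i <= q i.
  move=> xS i; apply: lb_le_inf; first by exists (z i); exists z.
  by move=> _ [y Sy ->]; apply: xS.
have q0 i : 0 <= q i by apply: (q_ge (fun=> 0)) => y [].
have Fq i : F q i <= q i.
  apply: (q_ge (F q)) => y Sy j; apply: (@le_trans _ _ (F y j)).
    by apply: Fmono => // k; apply: qS.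
  by case: Sy.
exists q; split=> // [i|x x0 Fx i]; last exact: qS.
apply/eqP; rewrite eq_le Fq qS //; split=> j; first exact: F0.
by apply: Fmono => // k; apply: F0.
Qed.

Lemma small_scaling (R : realFieldType) n (f g : 'I_n -> R) :
  (forall i, 0 <= f i) -> (forall i, 0 < g i) ->
  exists2 e, 0 < e & forall i, e * f i <= g i.
Proof.
(* The number [s] exceeds every ratio [f i / g i], so its inverse works for all coordinates at
   once. *)
move=> f0 g0; pose s := 1 + \sum_i f i / g i.
have fg0 i : 0 <= f i / g i by rewrite divr_ge0 // ltW.
have s0 : 0 < s by rewrite ltr_pwDl // sumr_ge0.
exists s^-1 => [|i]; first by rewrite invr_gt0.
rewrite mulrC ler_pdivrMr // mulrC -ler_pdivrMr // /s (bigD1 i) //=.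
rewrite addrCA lerDl addr_ge0 // sumr_ge0 //.
Qed.

Section Quadratic.
Variables (R : realFieldType) (n : nat).
Implicit Types (c x y z w : 'I_n -> R) (L : 'I_n -> 'I_n -> R).
Implicit Type T : 'I_n -> 'I_n -> 'I_n -> R.

Definition tmat T x (i j : 'I_n) : R := \sum_k T i j k * x k.

Definition quad c L T x i : R := c i + mv L x i + mv (tmat T x) x i.

(** The derivative of [quad] when [T] is symmetric in its last two indices, whence the factor 2. *)
Definition jac L T x (i j : 'I_n) : R := L i j + 2 * tmat T x i j.

Lemma mv_jac L T x y i : mv (jac L T x) y i = mv L y i + 2 * mv (tmat T x) y i.
Proof.
rewrite /mv mulr_sumr -big_split; apply: eq_bigr => j _.
by rewrite /jac mulrDl mulrA.
Qed.

Section Symmetric.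
Variables (c : 'I_n -> R) (L : 'I_n -> 'I_n -> R).
Variable T : 'I_n -> 'I_n -> 'I_n -> R.
Hypotheses (c_ge0 : forall i, 0 <= c i) (L_ge0 : forall i j, 0 <= L i j).
Hypotheses (T_ge0 : forall i j k, 0 <= T i j k).
Hypothesis T_sym : forall i j k, T i j k = T i k j.

Lemma tmatC x y i : mv (tmat T x) y i = mv (tmat T y) x i.
Proof.
rewrite /mv /tmat; under eq_bigr do rewrite mulr_suml.
rewrite exchange_big; apply: eq_bigr => k _; rewrite mulr_suml.
by apply: eq_bigr => j _; rewrite T_sym mulrAC.
Qed.

Lemma tmatB x y z i :
  mv (tmat T (fun j => x j - y j)) z i = mv (tmat T x) z i - mv (tmat T y) z i.
Proof. by rewrite tmatC mvB !(tmatC z). Qed.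

Lemma tmatZ a x z i :
  mv (tmat T (fun j => a * x j)) z i = a * mv (tmat T x) z i.
Proof. by rewrite tmatC mvZ (tmatC z). Qed.

Lemma tmat_ge0 x i j : (forall k, 0 <= x k) -> 0 <= tmat T x i j.
Proof. by move=> x0; apply: sumr_ge0 => k _; rewrite mulr_ge0. Qed.

Lemma le_tmat x y i j : (forall k, x k <= y k) -> tmat T x i j <= tmat T y i j.
Proof. by move=> xy; apply: ler_sum => k _; rewrite ler_wpM2l. Qed.

Lemma tmat_ge_term x i j k : (forall k, 0 <= x k) -> T i j k * x k <= tmat T x i j.
Proof.
move=> x0; rewrite /tmat (bigD1 k) //= lerDl.
by apply: sumr_ge0 => l _; rewrite mulr_ge0.
Qed.

Lemma tmat_form_ge_term x i j k : (forall k, 0 <= x k) ->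
  T i j k * x j * x k <= mv (tmat T x) x i.
Proof.
move=> x0; apply: le_trans (mv_ge_term j _ x0); last by move=> l; apply: tmat_ge0.
by rewrite mulrAC ler_wpM2r // tmat_ge_term.
Qed.

Lemma jac_ge0 x i j : (forall k, 0 <= x k) -> 0 <= jac L T x i j.
Proof. by move=> x0; rewrite addr_ge0 // mulr_ge0 // tmat_ge0. Qed.

(** The expansion is exact because the map has degree two. *)
Lemma quad_taylor x z i :
  quad c L T x i - quad c L T z i =
  mv (jac L T z) (fun j => x j - z j) i +
  mv (tmat T (fun j => x j - z j)) (fun j => x j - z j) i.
Proof.
rewrite /quad mv_jac tmatB !mvB (tmatC z x); ring.
Qed.

Lemma quad_ge0 x i : (forall j, 0 <= x j) -> 0 <= quad c L T x i.
Proof.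
move=> x0; rewrite /quad !addr_ge0 ?mv_ge0 // => j; exact: tmat_ge0.
Qed.

Lemma le_quad x y i : (forall j, 0 <= x j) -> (forall j, x j <= y j) ->
  quad c L T x i <= quad c L T y i.
Proof.
move=> x0 xy; have xy0 j : 0 <= y j - x j by rewrite subr_ge0.
rewrite -subr_ge0 quad_taylor addr_ge0 // mv_ge0 // => j; first exact: jac_ge0.
exact: tmat_ge0.
Qed.

End Symmetric.

Lemma le_jac L L' T x y i j : (forall i j k, 0 <= T i j k) ->
  (forall i j, L i j <= L' i j) -> (forall k, x k <= y k) ->
  jac L T x i j <= jac L' T y i j.
Proof. by move=> T0 LL xy; rewrite lerD // ler_pM2l // le_tmat. Qed.

End Quadratic.

(** * Cone vectors at the least fixed point of a strongly connected system *)

Section ConnectedQuadratic.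
Variables (R : realType) (n : nat) (i0 : 'I_n).
Variables (c1 : 'I_n -> R) (L1 : 'I_n -> 'I_n -> R).
Variables (T : 'I_n -> 'I_n -> 'I_n -> R) (q1 : 'I_n -> R).
Hypotheses (c1_ge0 : forall i, 0 <= c1 i) (L1_ge0 : forall i j, 0 <= L1 i j).
Hypotheses (T_ge0 : forall i j k, 0 <= T i j k).
Hypothesis T_sym : forall i j k, T i j k = T i k j.
Hypothesis q1_gt0 : forall i, 0 < q1 i.
Hypothesis q1_fix : forall i, quad c1 L1 T q1 i = q1 i.
Hypothesis q1_least : forall x, (forall i, 0 <= x i) ->
  (forall i, quad c1 L1 T x i <= x i) -> forall i, q1 i <= x i.
Variables (E : rel 'I_n) (E_conn : forall i j, connect E i j).
Variables (a : R) (a_gt0 : 0 < a) (a_le1 : a <= 1).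
Hypothesis E_jac : forall i j, E i j -> a <= jac L1 T (fun k => q1 k / 2) i j.

Let q1_ge0 i : 0 <= q1 i.
Proof. exact: ltW. Qed.

Let half_le i : q1 i / 2 <= q1 i.
Proof. by have := q1_ge0 i; lra. Qed.

Let J1 := jac L1 T q1.

Let J1_ge0 i j : 0 <= J1 i j.
Proof. exact: jac_ge0. Qed.

(** The bound at [q1 / 2] thus serves both at [q1] and at the midpoint of [q1] with any smaller
    nonnegative fixed point. *)
Lemma jac_edge x i j : (forall k, q1 k / 2 <= x k) -> E i j -> a <= jac L1 T x i j.
Proof. by move=> qx /E_jac/le_trans; apply; apply: le_jac. Qed.

Let J1_edge i j : E i j -> a <= J1 i j.
Proof. exact: jac_edge. Qed.

(* Moving from [q1] down along an expanding [v] would reach a smaller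
   post-fixed point. *)
Lemma lfp_not_expanding :
  ~ (exists2 v, forall j, 0 <= v j & forall i, v i < mv J1 v i).
Proof.
case=> v v0 vJ.
(* A step of length at most [e1] keeps [q1 - e v] nonnegative; one of length at most [e2] lets the
   strict first-order gain absorb the second-order term. *)
have [e1 e10 e1P] := small_scaling v0 q1_gt0.
have [||e2 e20 e2P] := @small_scaling _ _ (fun i => mv (tmat T v) v i)
    (fun i => mv J1 v i - v i).
- by move=> i; apply: mv_ge0 => // j; apply: tmat_ge0.
- by move=> i; rewrite subr_gt0.
pose e := Num.min e1 e2; have e0 : 0 < e by rewrite lt_min e10.
have ee1 : e <= e1 by rewrite ge_min lexx.
have ee2 : e <= e2 by rewrite ge_min lexx orbT.
have le_v i : q1 i <= q1 i - e * v i.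
  apply: (q1_least (x := fun i => q1 i - e * v i)) i => i.
    rewrite subr_ge0; apply: le_trans (e1P i).
    by rewrite ler_wpM2r.
  have := quad_taylor c1 L1 T_sym q1 (fun i => q1 i - e * v i) i.
  have E1 B : mv B (fun j => q1 j - (q1 j - e * v j)) i = e * mv B v i.
    by rewrite -mvZ; apply: eq_bigr => j _; congr (_ * _); ring.
  rewrite q1_fix !mv_jac !E1 !tmatB // !tmatZ // => tay.
  have := e2P i; rewrite /J1 mv_jac => h.
  have h' : e * mv (tmat T v) v i <= mv L1 v i + 2 * mv (tmat T q1) v i - v i.
    apply: le_trans h; rewrite ler_wpM2r // mv_ge0 // => j; exact: tmat_ge0.
  by have := ler_wpM2l (ltW e0) h'; nra.
(* Leastness of [q1] leaves only a nonpositive [v], and then [mv J1 v] is nonpositive as well, so it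
   cannot exceed [v i0 >= 0]. *)
have v_le0 i : v i <= 0 by rewrite -(pmulr_rle0 _ e0); have := le_v i; lra.
have := vJ i0; apply/negP; rewrite -leNgt.
apply: le_trans (v0 i0); rewrite /mv; apply: sumr_le0 => j _.
by rewrite mulr_ge0_le0.
Qed.

Lemma right_cone_ratio d i j : (forall i, 0 <= d i) ->
  (forall i, mv J1 d i <= d i) -> a ^+ n.-1 * d j <= d i.
Proof.
move=> d0 Jd; apply: (connected_ratio E_conn) => // [|k l kl].
  by rewrite ltW.
apply: le_trans (Jd k); apply: le_trans (mv_ge_term l _ d0) => //.
by rewrite ler_wpM2r // J1_edge.
Qed.

(** The transpose traverses edges backwards, which preserves strong connectivity. The matrix is left
    general because rows of the inverse of I - L1 are treated this way too. *)
Lemma left_cone_ratio B u i j : (forall i j, 0 <= B i j) ->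
  (forall i j, E i j -> a <= B i j) -> (forall i, 0 <= u i) ->
  (forall j, mv (tr B) u j <= u j) -> a ^+ n.-1 * u j <= u i.
Proof.
move=> B0 EB u0 uB.
apply: (@connected_ratio _ _ (fun k l => E l k)) => // [k l||k l lk].
- by rewrite connect_rev; apply: E_conn.
- by rewrite ltW.
apply: le_trans (uB k); apply: le_trans (mv_ge_term (B := tr B) l _ u0) => //.
  by rewrite ler_wpM2r // EB.
by move=> m; apply: B0.
Qed.

Lemma lfp_left_cone : exists u, [/\ forall i, 0 < u i,
  forall j, mv (tr J1) u j <= u j & forall i j, a ^+ n.-1 * u j <= u i].
Proof.
have [u [u0 [k uk] uJ]] := exists_left_cone lfp_not_expanding.
have ur i j : a ^+ n.-1 * u j <= u i.
  by apply: (left_cone_ratio (B := J1)) => // k' l'; apply: J1_edge.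
by exists u; split=> // i; apply: lt_le_trans (ur i k); rewrite mulr_gt0 // exprn_gt0.
Qed.

Lemma lfp_right_cone : exists d, [/\ forall i, 0 < d i,
  forall i, mv J1 d i <= d i & forall i j, a ^+ n.-1 * d j <= d i].
Proof.
have [u [u0 uJ _]] := lfp_left_cone.
have [d [d0 [k dk] dJ]] := exists_right_cone i0 J1_ge0 u0 uJ.
have dr i j : a ^+ n.-1 * d j <= d i by apply: right_cone_ratio.
by exists d; split=> // i; apply: lt_le_trans (dr i k); rewrite mulr_gt0 // exprn_gt0.
Qed.

(** * The gap between the fixed points of the original and the perturbed system *)

Section Perturbation.
Variables (c2 : 'I_n -> R) (L2 : 'I_n -> 'I_n -> R) (q2 : 'I_n -> R).
Hypothesis c2_le : forall i, c2 i <= c1 i.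
Hypothesis L2_ge0 : forall i j, 0 <= L2 i j.
Hypothesis L2_le : forall i j, L2 i j <= L1 i j.
Hypotheses (q2_ge0 : forall i, 0 <= q2 i) (q2_le : forall i, q2 i <= q1 i).
Hypothesis q2_fix : forall i, quad c2 L2 T q2 i = q2 i.

Let d i := q1 i - q2 i.
Let d_ge0 i : 0 <= d i.
Proof. by rewrite subr_ge0. Qed.

Let M i := 2^-1 * (q1 i + q2 i).

(** For a quadratic map, a difference of two values is exactly the Jacobian at the midpoint applied
    to the difference of the arguments. *)
Lemma lfp_gap_equation i :
  d i = mv (jac L1 T M) d i + (quad c1 L1 T q2 i - quad c2 L2 T q2 i).
Proof.
have tay : quad c1 L1 T q1 i - quad c1 L1 T q2 i =
    mv (jac L1 T q2) d i + mv (tmat T d) d i by apply: quad_taylor.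
have dd : mv (tmat T d) d i = mv (tmat T q1) d i - mv (tmat T q2) d i.
  exact: tmatB.
have Md : mv (tmat T M) d i = 2^-1 * (mv (tmat T q1) d i + mv (tmat T q2) d i).
  by rewrite tmatC // mvZ mvD !(tmatC T_sym d).
move: tay; rewrite q1_fix q2_fix !mv_jac dd Md => tay.
by rewrite {1}/d; lra.
Qed.

Let M_jac_ge0 i j : 0 <= jac L1 T M i j.
Proof. by apply: jac_ge0 => // k; rewrite mulr_ge0 ?invr_ge0 ?addr_ge0. Qed.

(** The perturbation term of the gap equation is nonnegative, so the Jacobian at [M] does not expand
    [d]; and [M] dominates [q1 / 2]. *)
Lemma lfp_gap_ratio i j : a ^+ n.-1 * d j <= d i.
Proof.
apply: (connected_ratio E_conn) => // [|k l kl]; first by rewrite ltW.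
rewrite [leRHS]lfp_gap_equation.
apply: (@le_trans _ _ (mv (jac L1 T M) d k)).
  apply: le_trans (mv_ge_term l _ d_ge0) => //.
  rewrite ler_wpM2r // jac_edge // => m.
  by rewrite /M; have := q2_ge0 m; lra.
by rewrite lerDl subr_ge0 !lerD // le_mvl.
Qed.

(** Of the three factors [a ^+ n.-1], one compares the entries of the left cone vector [u], and two
    replace [d j] and [d k] by [d l]. *)
Lemma lfp_gap_quadratic eps i j k l : 0 <= eps ->
  (forall i, quad c1 L1 T q2 i - quad c2 L2 T q2 i <= eps) ->
  T i j k * (a ^+ n.-1) ^+ 3 * d l ^+ 2 <= n%:R * eps.
Proof.
move=> eps0 e_le; have [u [u0 uJ ur]] := lfp_left_cone.
have an0 : 0 < a ^+ n.-1 by rewrite exprn_gt0.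
(* The Jacobians at [q1] and at the midpoint [M] differ on [d] by exactly the quadratic form in [d].
   Pairing with [u] bounds the [J1] term by the pairing of [u] with [d]. *)
have h1 : \sum_i u i * mv (tmat T d) d i <= \sum_i u i * eps.
  have h : \sum_i u i * mv J1 d i <= \sum_i u i * d i.
    by rewrite sum_mv_tr; apply: ler_sum => m _; rewrite ler_wpM2r.
  apply: (@le_trans _ _ (\sum_i u i * (d i - mv (jac L1 T M) d i))); last first.
    apply: ler_sum => m _; rewrite ler_pM2l //.
    by rewrite {1}lfp_gap_equation addrC addKr.
  have -> : \sum_i u i * mv (tmat T d) d i =
            \sum_i u i * mv J1 d i - \sum_i u i * mv (jac L1 T M) d i.
    rewrite -sumrB; apply: eq_bigr => m _; rewrite -mulrBr; congr (_ * _).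
    have -> : mv (tmat T d) d m = mv (tmat T q1) d m - mv (tmat T q2) d m.
      exact: tmatB.
    have Md : mv (tmat T M) d m = 2^-1 * (mv (tmat T q1) d m + mv (tmat T q2) d m).
      by rewrite tmatC // mvZ mvD !(tmatC T_sym d).
    by rewrite !mv_jac Md; lra.
  under [leRHS]eq_bigr do rewrite mulrBr.
  by rewrite sumrB lerB.
have h2 : u i * (T i j k * d j * d k) <= \sum_i u i * eps.
  apply: le_trans h1; rewrite (bigD1 i) //=.
  apply: ler_wpDr; last by rewrite ler_pM2l // tmat_form_ge_term.
  apply: sumr_ge0 => m _; rewrite mulr_ge0 ?(ltW (u0 _)) // mv_ge0 // => p.
  exact: tmat_ge0.
have h3 : a ^+ n.-1 * \sum_i u i * eps <= u i * (n%:R * eps).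
  rewrite mulr_sumr; apply: (@le_trans _ _ (\sum_(m < n) u i * eps)).
    by apply: ler_sum => m _; rewrite mulrA ler_wpM2r.
  rewrite sumr_const card_ord -[_ *+ n]mulr_natr le_eqVlt.
  apply/orP; left; apply/eqP; ring.
rewrite -(ler_pM2l (u0 i)); apply: le_trans h3.
apply: le_trans (ler_wpM2l (ltW an0) h2).
have -> : u i * (T i j k * (a ^+ n.-1) ^+ 3 * d l ^+ 2) =
  a ^+ n.-1 * (u i * (T i j k * ((a ^+ n.-1 * d l) * (a ^+ n.-1 * d l)))) by ring.
rewrite ler_pM2l // ler_pM2l // -[in leRHS]mulrA ler_wpM2l //.
by rewrite ler_pM // ?mulr_ge0 ?(ltW an0) // lfp_gap_ratio.
Qed.

(** * The linear case *)

Section LinearGap.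
Hypothesis T0 : forall i j k, T i j k = 0.

Let tmat0 x i j : tmat T x i j = 0.
Proof. by rewrite /tmat big1 // => k _; rewrite T0 mul0r. Qed.

Let jac0 L x i j : jac L T x i j = L i j.
Proof. by rewrite /jac tmat0 mulr0 addr0. Qed.

Let q1_linear i : mv L1 q1 i = q1 i - c1 i.
Proof.
have tm0 : mv (tmat T q1) q1 i = 0 by rewrite /mv big1 // => j _; rewrite tmat0 mul0r.
by have := q1_fix i; rewrite /quad tm0; lra.
Qed.

(** Without a constant term, 0 would be a fixed point below the positive [q1]. *)
Lemma lfp_const_gt0 : exists k, 0 < c1 k.
Proof.
case: (pickP (fun k => 0 < c1 k)) => [k ck|c0]; first by exists k.
suff /(_ i0) : forall i, q1 i <= 0 by rewrite leNgt q1_gt0.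
apply: (q1_least (x := fun=> 0)) => // i; rewrite /quad /mv.
rewrite !big1 => [|j _|j _]; rewrite ?mulr0 // !addr0.
by rewrite leNgt c0.
Qed.

(** Here [q1] itself serves as the comparison vector: [L1] maps it to [q1 - c1], which is strictly
    smaller where [c1] is positive. *)
Lemma linear_monotone_resolvent C : (forall i j, 0 <= C i j <= L1 i j) ->
  monotone_resolvent C.
Proof.
move=> CL y Cy; have [k ck] := lfp_const_gt0.
apply: (@subcone_monotone _ _ E E_conn L1 C q1 y k) => //.
- by move=> i j /J1_edge; rewrite /J1 jac0; apply: lt_le_trans.
- by move=> i; rewrite q1_linear gerBl.
apply: (@le_lt_trans _ _ (mv L1 q1 k)); last by rewrite q1_linear gtrBl.
by apply: le_mvl => // j; case/andP: (CL k j).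
Qed.

(** With [G] the inverse of I - L1, the gap is [G] applied to a vector bounded by [eps], so it
    suffices to bound the entries of [G]. *)
Lemma lfp_gap_linear eps k l : 0 <= eps -> (forall i, q1 i <= 1) ->
  (forall i, quad c1 L1 T q2 i - quad c2 L2 T q2 i <= eps) ->
  c1 k * a ^+ n.-1 * d l <= n%:R * eps.
Proof.
move=> eps0 q11 e_le; pose B : 'M[R]_n := \matrix_(i, j) L1 i j.
have mvB_L x i : mv B x i = mv L1 x i by apply: eq_bigr => j _; rewrite mxE.
have Bmono : monotone_resolvent B.
  apply: linear_monotone_resolvent => i j.
  by rewrite mxE lexx L1_ge0.
pose G := invmx (1%:M - B).
have G0 i j : 0 <= G i j by apply: monotone_resolvent_inv.
have GB x i : \sum_j G i j * (x j - mv L1 x j) = x i.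
  pose X : 'cV[R]_n := \col_j x j.
  have : (G *m ((1%:M - B) *m X)) i 0 = x i.
    by rewrite mulmxA mulVmx ?mul1mx ?mxE // monotone_resolvent_unit.
  rewrite mxE => <-; apply: eq_bigr => j _; rewrite mulmx_resolvent mxE mvB_L.
  by congr (_ * (_ - _)); apply: eq_bigr => m _; rewrite mxE.
(* Since G (I - L1) is the identity, hence nonnegative, each row of [G] is a left cone vector and
   its entries are comparable. *)
have Gtr j : mv (tr L1) (G l) j <= G l j.
  have := GB (fun m => (m == j)%:R) l.
  have -> : \sum_m G l m * ((m == j)%:R - mv L1 (fun p => (p == j)%:R) m) =
      G l j - mv (tr L1) (G l) j.
    have mvd m : mv L1 (fun p => (p == j)%:R) m = L1 m j.
      rewrite /mv (bigD1 j) //= eqxx mulr1 big1 ?addr0 // => p /negPf->.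
      by rewrite mulr0.
    under eq_bigr do rewrite mvd mulrBr; rewrite sumrB; congr (_ - _).
      rewrite (bigD1 j) //= eqxx mulr1 big1 ?addr0 // => p /negPf->.
      by rewrite mulr0.
    by apply: eq_bigr => m _; rewrite mulrC.
  by move=> e; rewrite -subr_ge0 e ler0n.
have Gr j : a ^+ n.-1 * G l j <= G l k.
  apply: (left_cone_ratio (B := L1)) => // i m /J1_edge.
  by rewrite /J1 jac0.
(* [G] maps [c1] to [q1 <= 1], which caps the entry of [G] in a column where [c1] is positive. *)
have Gc : G l k * c1 k <= 1.
  apply: le_trans (q11 l); rewrite -(GB q1 l) (bigD1 k) //= q1_linear.
  have -> : q1 k - (q1 k - c1 k) = c1 k by ring.
  rewrite lerDl; apply: sumr_ge0 => j _; rewrite q1_linear mulr_ge0 //.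
  by rewrite opprB addrC subrK.
have -> : d l = \sum_j G l j * (d j - mv L1 d j) by rewrite GB.
rewrite mulr_sumr; apply: (@le_trans _ _ (\sum_(j < n) eps)); last first.
  by rewrite sumr_const card_ord mulr_natl.
apply: ler_sum => j _.
have e1 : d j - mv L1 d j <= eps.
  rewrite {1}lfp_gap_equation.
  have -> : mv (jac L1 T M) d j = mv L1 d j.
    by apply: eq_bigr => m _; rewrite jac0.
  by rewrite addrC addKr.
apply: (@le_trans _ _ (c1 k * a ^+ n.-1 * (G l j * eps))).
  by rewrite ler_wpM2l ?mulr_ge0 // ?exprn_ge0 ?(ltW a_gt0) // ler_wpM2l.
rewrite [leLHS](_ : _ = c1 k * (a ^+ n.-1 * G l j) * eps); last by ring.
rewrite -[leRHS]mul1r ler_wpM2r //; apply: le_trans Gc.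
by rewrite mulrC ler_wpM2r.
Qed.

End LinearGap.

(** * One exact Newton step from a point below the fixed point *)

Section NewtonStep.
Variables (x N : 'I_n -> R).
Hypotheses (x_ge0 : forall i, 0 <= x i) (x_le : forall i, x i <= q2 i).

Let C := jac L2 T x.

Let C_bounds i j : 0 <= C i j <= J1 i j.
Proof.
rewrite jac_ge0 //=; apply: le_jac => // k.
exact: le_trans (x_le k) (q2_le k).
Qed.

(** Strictness of [x < q1] at [k] makes the entry (i, j) of [C] strictly smaller than that of [J1],
    so [C] strictly contracts the right cone vector at [i]. *)
Lemma nonlinear_monotone_resolvent i j k : 0 < T i j k ->
  (forall l, x l < q1 l) -> monotone_resolvent C.
Proof.
move=> Tijk xq y Cy; have [w [w0 wJ _]] := lfp_right_cone.
apply: (@subcone_monotone _ _ E E_conn J1 C w y i) => //.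
  by move=> p l /J1_edge; apply: lt_le_trans.
apply: lt_le_trans (wJ i).
rewrite /mv (bigD1 j) //= [ltRHS](bigD1 j) //=.
apply: ltr_leD; last first.
  by apply: ler_sum => l _; rewrite ler_wpM2r ?(ltW (w0 _)) //;
    case/andP: (C_bounds i l).
rewrite ltr_pM2r // /C /J1 /jac ler_ltD // ltr_pM2l //.
rewrite /tmat (bigD1 k) //= [ltRHS](bigD1 k) //=.
apply: ltr_leD; first by rewrite ltr_pM2l.
by apply: ler_sum => l _; rewrite ler_wpM2l // ltW.
Qed.

Hypothesis C_mono : monotone_resolvent C.
Hypothesis N_newton : forall i,
  (N i - x i) - mv C (fun j => N j - x j) i = quad c2 L2 T x i - x i.

(** Subtracting the Newton equation from the expansion at [x] leaves the second-order term and the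
    defect of [p]. It is used for [q2], whose defect is zero, and for the post-fixed point [q1]. *)
Lemma newton_residual p i :
  (p i - N i) - mv C (fun j => p j - N j) i =
  mv (tmat T (fun j => p j - x j)) (fun j => p j - x j) i +
  (p i - quad c2 L2 T p i).
Proof.
have := quad_taylor c2 L2 T_sym p x i; have := N_newton i.
by rewrite -/C !mvB; lra.
Qed.

Let form_ge0 y i : (forall j, 0 <= y j) -> 0 <= mv (tmat T y) y i.
Proof. by move=> y0; apply: mv_ge0 => // j; apply: tmat_ge0. Qed.

Lemma newton_le_post p : (forall i, x i <= p i) ->
  (forall i, quad c2 L2 T p i <= p i) -> forall i, N i <= p i.
Proof.
move=> xp Fp i; rewrite -subr_ge0; apply: (C_mono (y := fun i => p i - N i)) i => i.
rewrite -subr_ge0 newton_residual addr_ge0 ?subr_ge0 // form_ge0 // => j.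
by rewrite subr_ge0.
Qed.

Lemma newton_le_lfp i : N i <= q2 i.
Proof. by apply: newton_le_post i => // i; rewrite q2_fix. Qed.

(** Put g = q2 - x. Then I - C maps q2 - N to T(g) g, at most lam T(g) w, and maps [w] to at least 2
    T(g) w, because the Jacobian at [q2] does not expand [w]. The 2 is the halving. *)
Lemma newton_halves_gap w lam : (forall i, 0 <= w i) ->
  (forall i, mv J1 w i <= w i) -> 0 <= lam ->
  (forall i, q2 i - x i <= lam * w i) ->
  forall i, q2 i - N i <= lam / 2 * w i.
Proof.
move=> w0 wJ lam0 gap i; rewrite -subr_ge0.
pose g j := q2 j - x j; have g0 j : 0 <= g j by rewrite subr_ge0.
apply: (C_mono (y := fun i => lam / 2 * w i - (q2 i - N i))) i => i.
rewrite mvB mvZ.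
have res : (q2 i - N i) - mv C (fun j => q2 j - N j) i = mv (tmat T g) g i.
  by rewrite newton_residual q2_fix subrr addr0.
have gg : mv (tmat T g) g i <= lam * mv (tmat T g) w i.
  by rewrite -mvZ; apply: le_mv => // j; apply: tmat_ge0.
have h1 : mv (jac L2 T q2) w i <= w i.
  by apply: le_trans (wJ i); apply: le_mvl => // j; apply: le_jac.
have gw : mv (tmat T g) w i = mv (tmat T q2) w i - mv (tmat T x) w i.
  exact: tmatB.
have := ler_wpM2l lam0 h1; rewrite -subr_ge0.
by move: res gg; rewrite gw /C !mv_jac; lra.
Qed.

(* Where [N] touches [q1] the equation is linear and unperturbed, and the
   contact spreads along the edges to a nonlinear equation. *)
Lemma newton_lt_lfp i j k : 0 < T i j k -> (forall l, x l < q1 l) ->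
  forall l, N l < q1 l.
Proof.
move=> Tijk xq l; pose e m := q1 m - N m; pose g m := q1 m - x m.
have g0 m : 0 < g m by rewrite subr_gt0.
have F2q m : quad c1 L1 T q1 m - quad c2 L2 T q1 m =
    (c1 m - c2 m) + \sum_p (L1 m p - L2 m p) * q1 p.
  have -> : \sum_p (L1 m p - L2 m p) * q1 p = mv L1 q1 m - mv L2 q1 m.
    by rewrite /mv -sumrB; apply: eq_bigr => p _; rewrite mulrBl.
  by rewrite /quad; ring.
have S0 m p : 0 <= (L1 m p - L2 m p) * q1 p by rewrite mulr_ge0 // subr_ge0.
have e0 m : 0 <= e m.
  rewrite subr_ge0; apply: newton_le_post m => m; first exact: ltW.
  by rewrite -[leRHS]q1_fix -subr_ge0 F2q addr_ge0 ?subr_ge0 // sumr_ge0.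
have key m : e m = 0 -> (forall p r, T m p r = 0) /\ (forall p, E m p -> e p = 0).
  move=> em.
  (* When [e m = 0] this exhibits zero as a sum of four nonnegative terms, so each of them
     vanishes. *)
  have res : e m - mv C e m = mv (tmat T g) g m +
      ((c1 m - c2 m) + \sum_p (L1 m p - L2 m p) * q1 p).
    by rewrite -F2q q1_fix; apply: newton_residual.
  have h1 : 0 <= mv C e m by apply: mv_ge0 => // p; case/andP: (C_bounds m p).
  have h2 : 0 <= mv (tmat T g) g m by apply: form_ge0 => p; apply: ltW.
  have h3 : 0 <= \sum_p (L1 m p - L2 m p) * q1 p by apply: sumr_ge0.
  have h4 : 0 <= c1 m - c2 m by rewrite subr_ge0.
  have Ce : mv C e m = 0 by lra.
  have Tg : mv (tmat T g) g m = 0 by lra.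
  have LL : \sum_p (L1 m p - L2 m p) * q1 p = 0 by lra.
  have Tm p r : T m p r = 0.
    have := @tmat_form_ge_term _ _ T T_ge0 g m p r (fun s => ltW (g0 s)).
    rewrite Tg -mulrA => le0; apply/eqP; rewrite eq_le T_ge0 andbT.
    by move: le0; rewrite pmulr_lle0 // mulr_gt0.
  split=> // p Emp.
  have L12 : L1 m p = L2 m p.
    have /psumr_eq0P : forall s, true -> 0 <= (L1 m s - L2 m s) * q1 s by [].
    move/(_ LL p isT)/eqP; rewrite mulf_eq0 (gt_eqF (q1_gt0 p)) orbF subr_eq0.
    by move/eqP.
  have jm L y : jac L T y m p = L m p.
    by rewrite /jac /tmat big1 ?mulr0 ?addr0 // => s _; rewrite Tm mul0r.
  have Cmp : 0 < C m p.
    by rewrite /C jm -L12 -(jm L1 q1); apply: lt_le_trans (J1_edge Emp).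
  have /psumr_eq0P : forall s, true -> 0 <= C m s * e s.
    by move=> s _; rewrite mulr_ge0 //; case/andP: (C_bounds m s).
  move/(_ Ce p isT)/eqP; rewrite mulf_eq0 (gt_eqF Cmp) /=.
  by move/eqP.
rewrite -subr_gt0 lt_neqAle e0 andbT; apply/eqP => el.
have : e i = 0.
  by apply: (@connect_invariant _ E (fun m => e m = 0) l i) => // p r pr /key[_]; apply.
by move/key=> [Ti _]; rewrite Ti ltxx in Tijk.
Qed.

End NewtonStep.
(** In the linear case Newton's method may reach [q1] itself, so strictness is demanded only when
    [T] is nonzero. *)
Definition newton_invariant (x : 'I_n -> R) : Prop :=
  [/\ forall i, 0 <= x i, forall i, x i <= q2 i &
      (forall i j k, T i j k = 0) \/ (forall i, x i < q1 i)].

Lemma linear_or_nonlinear :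
  (forall i j k, T i j k = 0) \/ (exists i j k, 0 < T i j k).
Proof.
case: (pickP (fun t : 'I_n * 'I_n * 'I_n => 0 < T t.1.1 t.1.2 t.2)).
  by case=> -[i j] k /= Tijk; right; exists i, j, k.
move=> T0; left=> i j k; apply/eqP; rewrite eq_le T_ge0 andbT leNgt.
by rewrite (T0 (i, j, k)).
Qed.

Lemma newton_invariant_resolvent x :
  newton_invariant x -> monotone_resolvent (jac L2 T x).
Proof.
case=> x0 xq lin_or; case: linear_or_nonlinear => [T0|[i [j [k Tijk]]]].
  apply: linear_monotone_resolvent => // i j.
  rewrite /jac /tmat big1 => [|k _]; last by rewrite T0 mul0r.
  by rewrite mulr0 addr0 L2_ge0 L2_le.
apply: (nonlinear_monotone_resolvent x0 xq Tijk).
by case: lin_or => // T0; rewrite T0 ltxx in Tijk.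
Qed.

(** Rounding enters only through the two bounds on [x']. *)
Lemma newton_invariant_step x N x' : newton_invariant x ->
  (forall i, (N i - x i) - mv (jac L2 T x) (fun j => N j - x j) i =
             quad c2 L2 T x i - x i) ->
  (forall i, 0 <= x' i <= Num.max (N i) 0) -> newton_invariant x'.
Proof.
move=> inv_x N_newton x'_bounds; have Cmono := newton_invariant_resolvent inv_x.
case: inv_x => x0 xq lin_or.
have x'_le i : x' i <= Num.max (N i) 0 by case/andP: (x'_bounds i).
split=> [i|i|]; first by case/andP: (x'_bounds i).
  apply: le_trans (x'_le i) _; rewrite ge_max q2_ge0 andbT.
  exact: (newton_le_lfp xq Cmono N_newton).
case: linear_or_nonlinear => [T0|[i [j [k Tijk]]]]; first by left.
right=> l; apply: le_lt_trans (x'_le l) _; rewrite gt_max q1_gt0 andbT.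
apply: (newton_lt_lfp x0 xq Cmono N_newton Tijk).
by case: lin_or => // T0; rewrite T0 ltxx in Tijk.
Qed.

Variable F : 'I_n -> {mpoly R[n]}.
Hypothesis F_eval : forall z i,
  pvec_eval F z i 0 = quad c2 L2 T (fun j => z j 0) i.
Hypothesis F_jac : forall z i j,
  jacobian F z i j = jac L2 T (fun k => z k 0) i j.

Lemma newton_defined (z : 'cV[R]_n) : newton_invariant (fun i => z i 0) ->
  exists2 N, newton F z = Some N & forall i,
    (N i 0 - z i 0) - mv (jac L2 T (fun k => z k 0)) (fun j => N j 0 - z j 0) i =
    quad c2 L2 T (fun k => z k 0) i - z i 0.
Proof.
move=> inv_z; have Bmono : monotone_resolvent (jacobian F z).
  move=> y By; apply: (newton_invariant_resolvent inv_z) => i.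
  by apply: le_trans (By i); rewrite le_eqVlt; apply/orP; left; apply/eqP;
    apply: eq_bigr => j _; rewrite F_jac.
have Bu := monotone_resolvent_unit Bmono.
rewrite /newton Bu; eexists; first by [].
set w := invmx _ *m _ => i.
have : ((1%:M - jacobian F z) *m w) i 0 = pvec_eval F z i 0 - z i 0.
  by rewrite mulmxA mulmxV // mul1mx !mxE.
rewrite F_eval mulmx_resolvent => <-.
have zw j : (z + w) j 0 - z j 0 = w j 0 by rewrite mxE addrAC subrr add0r.
by rewrite zw; congr (_ - _); apply: eq_bigr => j _; rewrite zw F_jac.
Qed.

(** A step halves the factor of [w], and rounding adds at most [2 ^- h], which [w >= 1] turns into a
    multiple of [w]. The stated factor is the solution of this recurrence with initial value
    [1 + 2 * 2 ^- h]. *)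
Lemma rnm_gap h g w : (forall i, 1 <= w i) -> (forall i, mv J1 w i <= w i) ->
  (forall i, q2 i <= 1) ->
  exists2 x, rnm F h g = Some x & newton_invariant (fun i => x i 0) /\
    forall i, q2 i - x i 0 <= (2 ^- g + 2 * 2 ^- h) * w i.
Proof.
move=> w1 wJ q21; have w0 i : 0 <= w i by apply: le_trans (w1 i).
have h0 : 0 < 2 ^+ h :> R by rewrite exprn_gt0.
have hV0 : 0 < 2 ^- h :> R by rewrite invr_gt0.
elim: g => [|g [x rx [inv_x gap]]].
  exists 0 => //; split.
    by split=> [i|i|]; [| |right=> i]; rewrite mxE.
  by move=> i; rewrite mxE subr0 expr0 invr1; have := q21 i; have := w1 i; nra.
have [N xN N_newton] := newton_defined inv_x.
exists (map_mx (round_down h) N); first by rewrite /= rx /= xN.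
pose r i := round_down h (N i 0).
have r_bounds i : 0 <= r i <= Num.max (N i 0) 0.
  by have [_ -> _] := round_downP h (N i 0); rewrite andbT divr_ge0 // ltW.
have r_gap i : N i 0 - r i <= 2 ^- h.
  apply: (@le_trans _ _ (Num.max (N i 0) 0 - r i)).
    by rewrite lerB // le_max lexx.
  rewrite /r /round_down -(ler_pM2r h0) mulVf ?gt_eqF // mulrBl divfK ?gt_eqF //.
  rewrite lerBlDl natr1 ltW // truncnS_gt //.
have inv_r : newton_invariant (fun i => map_mx (round_down h) N i 0).
  apply: (newton_invariant_step inv_x N_newton) => i; rewrite mxE.
  exact: r_bounds.
split=> // i; rewrite mxE -/(r i).
have Cmono := newton_invariant_resolvent inv_x.
case: inv_x => _ xq _.
have lam0 : 0 <= 2 ^- g + 2 * 2 ^- h :> R.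
  by rewrite addr_ge0 ?mulr_ge0 // invr_ge0 exprn_ge0.
have := newton_halves_gap xq Cmono N_newton w0 wJ lam0 gap i.
have : 2 ^- h <= 2 ^- h * w i by rewrite ler_pMr.
have := r_gap i; rewrite exprS invfM; lra.
Qed.

Lemma rnm_error h g : (forall i, q1 i <= 1) ->
  exists2 x, rnm F h g = Some x & forall i,
    0 <= q2 i - x i 0 <= (2 ^- g + 2 * 2 ^- h) / a ^+ n.-1.
Proof.
move=> q11; have [d' [d'0 d'J d'r]] := lfp_right_cone.
(* Scaled to have smallest entry 1, the right cone vector has all entries at most the inverse of
   [a ^+ n.-1]. *)
pose k := [arg min_(l < i0) d' l]%O.
have kmin l : d' k <= d' l.
  by rewrite /k; case: (@Order.TotalTheory.arg_minP _ _ _ i0 predT) => // m _; apply.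
pose w i := (d' k)^-1 * d' i.
have an0 : 0 < a ^+ n.-1 by rewrite exprn_gt0.
have [||i|x rx [[_ xq _] gap]] := @rnm_gap h g w.
- by move=> i; rewrite /w -(ler_pM2l (d'0 k)) mulrA mulfV ?gt_eqF // mul1r mulr1.
- by move=> i; rewrite mvZ ler_pM2l // invr_gt0.
- exact: le_trans (q2_le i) (q11 i).
exists x => // i; rewrite subr_ge0 xq /=; apply: le_trans (gap i) _.
rewrite ler_wpM2l //; first by rewrite addr_ge0 ?mulr_ge0 // invr_ge0 exprn_ge0.
by rewrite /w -(ler_pM2l (d'0 k)) mulrA mulfV ?gt_eqF // mul1r ler_pdivlMr // mulrC.
Qed.

End Perturbation.
End ConnectedQuadratic.

(** * Polynomials of degree two *)

Section QuadraticMpoly.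
Variables (R : realFieldType) (N : nat).
Implicit Types (p : {mpoly R[N]}) (l : 'I_N -> R) (t : 'I_N -> 'I_N -> R).

Definition quad_mpoly (c : R) l t : {mpoly R[N]} :=
  c%:MP + \sum_j l j *: 'X_j + \sum_j \sum_k t j k *: ('X_j * 'X_k).

Lemma mcoeff_quad_mpoly c l t mu : (quad_mpoly c l t)@_mu =
  c * (mu == 0%MM)%:R + \sum_j l j * (U_(j)%MM == mu)%:R +
  \sum_j \sum_k t j k * ((U_(j) + U_(k))%MM == mu)%:R.
Proof.
rewrite /quad_mpoly !mcoeffD mcoeffC !raddf_sum; congr (_ + _ + _).
  by apply: eq_bigr => j _; rewrite /= mcoeffZ mcoeffX.
apply: eq_bigr => j _; rewrite raddf_sum; apply: eq_bigr => k _ /=.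
by rewrite mcoeffZ -mpolyXD mcoeffX.
Qed.

Lemma meval_quad_mpoly c l t v : (quad_mpoly c l t).@[v] =
  c + \sum_j l j * v j + \sum_j \sum_k t j k * v j * v k.
Proof.
rewrite /quad_mpoly !mevalD mevalC !raddf_sum; congr (_ + _ + _).
  by apply: eq_bigr => j _; rewrite /= mevalZ mevalXU.
apply: eq_bigr => j _; rewrite raddf_sum; apply: eq_bigr => k _ /=.
by rewrite mevalZ mevalM !mevalXU mulrA.
Qed.

Lemma mderivXU (i j : 'I_N) : ('X_j : {mpoly R[N]})^`M(i) = (j == i)%:R%:MP.
Proof.
rewrite mderivX mnm1E; case: eqP => [->|_]; last by rewrite scale0r mpolyC0.
by rewrite scale1r -[X in (X - _)%MM]add0m addmK mpolyX0.
Qed.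

Lemma meval_mderiv_quad_mpoly c l t i v : (forall j k, t j k = t k j) ->
  ((quad_mpoly c l t)^`M(i)).@[v] = l i + 2 * \sum_k t i k * v k.
Proof.
move=> tsym; rewrite /quad_mpoly !mderivD mderivC add0r mevalD.
congr (_ + _).
  rewrite (raddf_sum (mderiv i)) (raddf_sum (meval v)) (bigD1 i) //=.
  rewrite mderivZ mderivXU eqxx mevalZ mevalC mulr1.
  rewrite big1 ?addr0 // => j /negPf ji.
  by rewrite mderivZ mderivXU ji mevalZ mevalC mulr0.
have E1 j : ((\sum_k t j k *: ('X_j * 'X_k))^`M(i)).@[v] =
    (j == i)%:R * (\sum_k t j k * v k) + t j i * v j.
  rewrite (raddf_sum (mderiv i)) (raddf_sum (meval v)) mulr_sumr /=.
  under eq_bigr do rewrite mderivZ mderivM !mderivXU mevalZ mevalD !mevalM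
    !mevalC !mevalXU mulrDr.
  rewrite big_split; congr (_ + _).
    by apply: eq_bigr => k _; ring.
  rewrite (bigD1 i) //= eqxx mulr1 big1 ?addr0 // => k /negPf ki.
  by rewrite ki !mulr0.
rewrite (raddf_sum (mderiv i)) (raddf_sum (meval v)); under eq_bigr do rewrite /= E1.
rewrite big_split /= (bigD1 i) //= eqxx mul1r [X in _ + X + _]big1 ?addr0; last first.
  by move=> j /negPf->; rewrite mul0r.
rewrite mulr_natl mulr2n; congr (_ + _).
by apply: eq_bigr => j _; rewrite tsym.
Qed.

(** [quad_mpoly] sums over ordered pairs and so meets a mixed monomial twice; halving its
    coefficient yields a symmetric tensor. *)
Definition quad_coef p (j k : 'I_N) : R :=
  (if j == k then 1 else 2^-1) * p@_(U_(j) + U_(k)).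

Lemma quad_coefC p j k : quad_coef p j k = quad_coef p k j.
Proof. by rewrite /quad_coef eq_sym addmC. Qed.

Lemma mnm1_eq (j k : 'I_N) : (U_(j)%MM == U_(k)%MM) = (j == k).
Proof.
apply/eqP/eqP => [/mnmP/(_ j)|->//].
by rewrite !mnm1E eqxx; case: eqP.
Qed.

Lemma addmU_eq (a b j k : 'I_N) :
  ((U_(j) + U_(k))%MM == (U_(a) + U_(b))%MM) =
  ((j == a) && (k == b)) || ((j == b) && (k == a)).
Proof.
case: (eqVneq j a) => [->|ja].
  rewrite eqm_add2l mnm1_eq; case: (eqVneq k b) => //= kb.
  by apply/esym/negbTE; apply: contra kb => /andP[/eqP<-].
case: (eqVneq j b) => [->|jb]; first by rewrite [(U_(a) + _)%MM]addmC eqm_add2l mnm1_eq.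
apply/negbTE/eqP => /mnmP/(_ j); rewrite !mnmDE !mnm1E eqxx.
by rewrite [a == j]eq_sym (negPf ja) [b == j]eq_sym (negPf jb).
Qed.

(** Coefficients are compared according to the degree of the monomial: 0, 1, 2 or larger. *)
Lemma quad_mpolyE p : (msize p <= 3)%N ->
  p = quad_mpoly p@_0 (fun j => p@_U_(j)) (quad_coef p).
Proof.
move=> p3; apply/mpolyP => mu; rewrite mcoeff_quad_mpoly.
have U0 (j : 'I_N) nu : mdeg nu != 1%N -> (U_(j)%MM == nu) = false.
  by move=> h; apply: contraNF h => /eqP<-; rewrite mdeg1.
have UU0 (j k : 'I_N) nu : mdeg nu != 2%N -> ((U_(j) + U_(k))%MM == nu) = false.
  by move=> h; apply: contraNF h => /eqP<-; rewrite mdegD !mdeg1.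
have s1 : mdeg mu != 1%N -> \sum_j p@_U_(j) * (U_(j)%MM == mu)%:R = 0.
  by move=> h; rewrite big1 // => j _; rewrite U0 // mulr0.
have s2 : mdeg mu != 2%N ->
    \sum_j \sum_k quad_coef p j k * ((U_(j) + U_(k))%MM == mu)%:R = 0.
  by move=> h; rewrite big1 // => j _; rewrite big1 // => k _; rewrite UU0 // mulr0.
case: (eqVneq mu 0%MM) => [mu0|mu0].
  by rewrite s1 ?s2 ?mu0 ?mdeg0 // mulr1 !addr0.
rewrite mulr0 add0r.
case: (eqVneq (mdeg mu) 1%N) => [d1|d1].
  rewrite s2 ?d1 // addr0; move/eqP: d1; case/mdeg1P => j /eqP->.
  rewrite (bigD1 j) //= eqxx mulr1 big1 ?addr0 // => k kj.
  case: eqP => [e|]; rewrite ?mulr0 //.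
  by move/mnmP/(_ j): e; rewrite !mnm1E eqxx (negPf kj).
rewrite s1 // add0r.
case: (eqVneq (mdeg mu) 2%N) => [d2|d2]; last first.
  rewrite s2 //; apply/eqP; rewrite mcoeff_eq0; apply: msize_mdeg_ge.
  apply: leq_trans p3 _; move: mu0 d1 d2; rewrite -mdeg_eq0.
  by case: (mdeg mu) => [|[|[|]]].
have [a a_mu] : exists a, (0 < mu a)%N.
  apply/existsP; apply: contraT; rewrite negb_exists => /forallP h.
  case/eqP: mu0; apply/mnmP => j; rewrite mnm0E; apply/eqP.
  by rewrite -leqn0 leqNgt.
have Ule : (U_(a) <= mu)%MM by rewrite lep1mP -lt0n.
have : mdeg (mu - U_(a)) == 1%N.
  by have := d2; rewrite -{1}(submK Ule) mdegD mdeg1 addn1 => -[->].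
case/mdeg1P => b /eqP eb.
have {eb} emu : mu = (U_(a) + U_(b))%MM by rewrite addmC -eb submK.
rewrite {mu0 d1 d2 a_mu Ule s1 s2}emu.
rewrite (bigD1 a) //= (bigD1 b) //= addmU_eq !eqxx mulr1.
(* A square comes from a single ordered pair; a mixed monomial comes from two, each giving half of
   the coefficient. *)
case: (eqVneq a b) => [<-|ab].
  rewrite !big1 ?addr0 /quad_coef ?eqxx ?mul1r // => [j ja|k ka].
    by rewrite big1 // => k _; rewrite addmU_eq (negPf ja) mulr0.
  by rewrite addmU_eq (negPf ka) andbF mulr0.
rewrite [X in _ + X + _]big1 ?addr0; last first.
  by move=> k kb; rewrite addmU_eq (negPf kb) (negPf ab) andbF mulr0.
rewrite (bigD1 b) 1?eq_sym //= (bigD1 a) //= addmU_eq !eqxx orbT mulr1.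
rewrite [X in _ + X + _]big1 ?addr0; last first.
  by move=> k ka; rewrite addmU_eq (negPf ka) [b == a]eq_sym (negPf ab) andbF mulr0.
rewrite big1 ?addr0; last first.
  move=> j /andP[ja jb]; rewrite big1 // => k _.
  by rewrite addmU_eq (negPf ja) (negPf jb) mulr0.
rewrite (quad_coefC p b a) /quad_coef (negPf ab).
by lra.
Qed.

End QuadraticMpoly.

Section Instantiate.
Variables (R : realType) (n m : nat) (P : 'I_n -> {mpoly R[n + m]}).
Variable y : 'cV[R]_m.

(** This part does not involve [y]: in degree two, a monomial quadratic in x leaves no room for y.
    Both instantiated systems therefore share the same tensor. *)
Definition tens_coef (i j k : 'I_n) : R :=
  quad_coef (P i) (lshift m j) (lshift m k).

Definition const_coef (i : 'I_n) : R :=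
  (P i)@_0 + \sum_b (P i)@_U_(rshift n b) * y b 0 +
  \sum_b \sum_c quad_coef (P i) (rshift n b) (rshift n c) * y b 0 * y c 0.

Definition lin_coef (i j : 'I_n) : R :=
  (P i)@_U_(lshift m j) +
  2 * \sum_b quad_coef (P i) (lshift m j) (rshift n b) * y b 0.

Lemma split_lshift (j : 'I_n) : split (lshift m j) = inl j.
Proof. exact: (unsplitK (inl j)). Qed.

Lemma split_rshift (b : 'I_m) : split (rshift n b) = inr b.
Proof. exact: (unsplitK (inr b)). Qed.

Lemma instantiate_quad i : degree_le P 2 ->
  instantiate P y i = quad_mpoly (const_coef i) (lin_coef i) (tens_coef i).
Proof.
move=> P2; rewrite /instantiate {1}(quad_mpolyE (P2 i)); set lq := mktuple _.
have lqE (v : 'I_(n + m)) : 'X_v \mPo lq = match split v with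
    | inl j => 'X_j | inr j => (y j 0)%:MP end.
  by rewrite comp_mpolyXU -tnth_nth tnth_mktuple.
have lql j : 'X_(lshift m j) \mPo lq = 'X_j by rewrite lqE split_lshift.
have lqr b : 'X_(rshift n b) \mPo lq = (y b 0)%:MP by rewrite lqE split_rshift.
set q := quad_coef (P i).
rewrite /quad_mpoly !comp_mpolyD comp_mpolyC.
have lin : (\sum_v (P i)@_U_(v) *: 'X_v) \mPo lq =
    \sum_j (P i)@_U_(lshift m j) *: 'X_j +
    (\sum_b (P i)@_U_(rshift n b) * y b 0)%:MP.
  rewrite (raddf_sum (comp_mpoly lq)) big_split_ord rmorph_sum /=.
  congr (_ + _); apply: eq_bigr => v _; rewrite comp_mpolyZ ?lql //.
  by rewrite lqr -mul_mpolyC -mpolyCM.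
have sq (v : 'I_(n + m)) : (\sum_w q v w *: ('X_v * 'X_w)) \mPo lq =
    (\sum_k q v (lshift m k) *: 'X_k + (\sum_b q v (rshift n b) * y b 0)%:MP)
    * ('X_v \mPo lq).
  rewrite (raddf_sum (comp_mpoly lq)) big_split_ord /= mulrDl; congr (_ + _).
    rewrite mulr_suml; apply: eq_bigr => k _.
    by rewrite comp_mpolyZ rmorphM /= lql -scalerAl mulrC.
  rewrite rmorph_sum mulr_suml; apply: eq_bigr => b _ /=.
  by rewrite comp_mpolyZ rmorphM /= lqr mpolyCM -mulrA mul_mpolyC mulrC.
have quadr : (\sum_v \sum_w q v w *: ('X_v * 'X_w)) \mPo lq =
    \sum_j \sum_k q (lshift m j) (lshift m k) *: ('X_j * 'X_k) +
    \sum_j (2 * \sum_b q (lshift m j) (rshift n b) * y b 0) *: 'X_j +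
    (\sum_b \sum_c q (rshift n b) (rshift n c) * y b 0 * y c 0)%:MP.
  rewrite (raddf_sum (comp_mpoly lq)) big_split_ord /=.
  under eq_bigr do rewrite sq lql mulrDl.
  under [X in _ + X]eq_bigr do rewrite sq lqr mulrDl.
  rewrite !big_split /= -!addrA; congr (_ + _).
    apply: eq_bigr => j _; rewrite mulr_suml; apply: eq_bigr => k _.
    by rewrite -scalerAl mulrC.
  rewrite addrA; congr (_ + _); last first.
    rewrite rmorph_sum; apply: eq_bigr => b _ /=.
    rewrite -mpolyCM mulr_suml; congr (_%:MP); apply: eq_bigr => c _.
    by rewrite mulrAC.
  (* The pairs (y, x) contribute the same as the pairs (x, y), which produces the 2 in
     [lin_coef]. *)
  have -> : \sum_b (\sum_k q (rshift n b) (lshift m k) *: 'X_k) * (y b 0)%:MP =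
      \sum_j (\sum_b q (lshift m j) (rshift n b) * y b 0)%:MP * 'X_j
      :> {mpoly R[n]}.
    under eq_bigr do rewrite mulr_suml.
    rewrite exchange_big; apply: eq_bigr => k _ /=; rewrite rmorph_sum mulr_suml.
    apply: eq_bigr => b _ /=; rewrite mpolyCM -mulrA mul_mpolyC mulrC -scalerAr.
    by rewrite /q quad_coefC mulrC.
  rewrite -big_split; apply: eq_bigr => j _ /=.
  by rewrite !mul_mpolyC -scalerDl; congr (_ *: _); ring.
rewrite lin quadr /const_coef /lin_coef /tens_coef.
under [X in _ = _ + X + _]eq_bigr do rewrite scalerDl.
rewrite big_split /= !mpolyCD -/q.
ring.
Qed.

End Instantiate.

(** * Instantiated polynomial systems *)

Section Minima.
Variable R : realType.

Lemma norm_inf_ge n (v : 'cV[R]_n) i : `|v i 0| <= norm_inf v.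
Proof.
rewrite /norm_inf matrix_normedtype.mx_normrE.
exact: (le_bigmax _ (fun ij => `|v ij.1 ij.2|) (i, 0)).
Qed.

Lemma norm_inf_le n (v : 'cV[R]_n) b :
  0 <= b -> (forall i, `|v i 0| <= b) -> norm_inf v <= b.
Proof.
move=> b0 vb; rewrite /norm_inf matrix_normedtype.mx_normrE.
by apply: bigmax_le => // -[i j] _; rewrite (ord1 j).
Qed.

Lemma vec_min_le n (v : 'cV[R]_n) i : vec_min v <= v i 0.
Proof.
have iv : v i 0 \in [seq v i 0 | i <- enum 'I_n].
  by apply/mapP; exists i; rewrite ?mem_enum.
by apply: (seq_minP _).2 => //; apply: contraTneq iv => ->.
Qed.

Lemma vec_min_attained n (v : 'cV[R]_n) : 'I_n -> exists i, vec_min v = v i 0.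
Proof.
move=> i; have iv : v i 0 \in [seq v i 0 | i <- enum 'I_n].
  by apply/mapP; exists i; rewrite ?mem_enum.
rewrite /vec_min.
have [|/mapP[j _ ->] _] := @seq_minP _ [seq v i 0 | i <- enum 'I_n].
  by apply: contraTneq iv => ->.
by exists j.
Qed.

Variables (n k : nat) (P : 'I_n -> {mpoly R[k]}).
Hypothesis P_ge0 : nonneg_coeffs P.

Let coeffs := flatten [seq [seq (P i)@_mu | mu <- msupp (P i)] | i <- enum 'I_n].

Lemma mem_coeffs i mu : (P i)@_mu != 0 -> (P i)@_mu \in coeffs.
Proof.
move=> c0; apply/flatten_mapP; exists i; rewrite ?mem_enum //.
by apply: map_f; rewrite mcoeff_msupp.
Qed.

Lemma coeff_min_le i mu : (P i)@_mu != 0 -> coeff_min P <= (P i)@_mu.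
Proof.
move/mem_coeffs=> c_in; apply: (seq_minP _).2 => //.
by apply: contraTneq c_in => e; rewrite /coeffs e.
Qed.

Lemma coeff_min_gt0 i mu : (P i)@_mu != 0 -> 0 < coeff_min P.
Proof.
move/mem_coeffs=> c_in; have [|min_in _] := @seq_minP _ coeffs.
  by apply: contraTneq c_in => ->.
rewrite /coeff_min -/coeffs.
have /flatten_mapP[j _ /mapP[nu nuP ->]] := min_in.
by rewrite lt_neqAle eq_sym -mcoeff_msupp nuP P_ge0.
Qed.

Lemma quad_coef_ge0 i j l : 0 <= quad_coef (P i) j l.
Proof. by rewrite mulr_ge0 //; case: eqP => // _; rewrite invr_ge0. Qed.

(** The factor 2 compensates for the halving of mixed coefficients. *)
Lemma coeff_min_quad_le i j l :
  0 < quad_coef (P i) j l -> coeff_min P <= 2 * quad_coef (P i) j l.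
Proof.
move=> q0; have c0 : (P i)@_(U_(j) + U_(l)) != 0.
  by apply: contraTneq q0 => e; rewrite /quad_coef e mulr0 ltxx.
have := coeff_min_le c0; have := P_ge0 i (U_(j) + U_(l))%MM.
by rewrite /quad_coef; case: eqP => _; lra.
Qed.

End Minima.

(** On the unit box each monomial of degree at most two changes by at most [2 * e], and the value at
    the all-ones vector is the sum of the coefficients. *)
Lemma meval_quad_gap (R : realType) N (p : {mpoly R[N]}) (z1 z2 : 'I_N -> R) e :
  (msize p <= 3)%N -> (forall mu, 0 <= p@_mu) ->
  (forall v, 0 <= z2 v <= z1 v) -> (forall v, z1 v <= 1) ->
  (forall v, z1 v - z2 v <= e) -> 0 <= e ->
  p.@[z1] - p.@[z2] <= 2 * e * p.@[fun=> 1].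
Proof.
move=> p3 p0 z21 z11 ze e0; rewrite (quad_mpolyE p3) !meval_quad_mpoly.
set c := p@_0; set q := quad_coef p.
have q0 j k : 0 <= q j k by rewrite mulr_ge0 //; case: eqP => // _; rewrite invr_ge0.
have z20 v : 0 <= z2 v by case/andP: (z21 v).
have z2le v : z2 v <= z1 v by case/andP: (z21 v).
have h1 : \sum_j p@_U_(j) * z1 j - \sum_j p@_U_(j) * z2 j <=
          2 * e * \sum_j p@_U_(j) * 1.
  rewrite -sumrB mulr_sumr; apply: ler_sum => j _.
  by have := p0 U_(j)%MM; have := ze j; nra.
have h2 : \sum_j \sum_k q j k * z1 j * z1 k - \sum_j \sum_k q j k * z2 j * z2 k <=
          2 * e * \sum_j \sum_k q j k * 1 * 1.
  rewrite -sumrB mulr_sumr; apply: ler_sum => j _.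
  rewrite -sumrB mulr_sumr; apply: ler_sum => k _.
  have -> : q j k * z1 j * z1 k - q j k * z2 j * z2 k =
      q j k * ((z1 j - z2 j) * z1 k + z2 j * (z1 k - z2 k)) by ring.
  rewrite !mulr1 [leRHS]mulrC ler_wpM2l //.
  have := ze j; have := ze k; have := z11 k; have := z2le k; have := z2le j.
  have := z20 k; have := z20 j; have := z11 j; nra.
have h3 : 0 <= 2 * e * c by rewrite !mulr_ge0 // p0.
by lra.
Qed.

Section InstantiateFacts.
Variables (R : realType) (n m : nat) (P : 'I_n -> {mpoly R[n + m]}).
Hypotheses (P_deg : degree_le P 2) (P_ge0 : nonneg_coeffs P).

Lemma meval_instantiate (y : 'cV[R]_m) (x : 'cV[R]_n) i :
  (instantiate P y i).@[fun j => x j 0] = (P i).@[fun v => col_mx x y v 0].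
Proof.
rewrite /instantiate comp_mpoly_meval; apply: meval_eq => v.
rewrite tnth_mktuple; case: (splitP v) => j jv.
  have -> : v = lshift m j by apply: val_inj.
  by rewrite col_mxEu mevalXU.
have -> : v = rshift n j by apply: val_inj.
by rewrite col_mxEd mevalC.
Qed.

Lemma tens_coefC i j k : tens_coef P i j k = tens_coef P i k j.
Proof. exact: quad_coefC. Qed.

Lemma tens_coef_ge0 i j k : 0 <= tens_coef P i j k.
Proof. exact: quad_coef_ge0. Qed.

Lemma pvec_eval_instantiate y (x : 'cV[R]_n) i :
  pvec_eval (instantiate P y) x i 0 =
  quad (const_coef P y) (lin_coef P y) (tens_coef P) (fun j => x j 0) i.
Proof.
rewrite mxE instantiate_quad // meval_quad_mpoly /quad; congr (_ + _).
apply: eq_bigr => j _; rewrite /tmat mulr_suml; apply: eq_bigr => k _.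
by rewrite mulrAC.
Qed.

Lemma jacobian_instantiate y (z : 'cV[R]_n) i j :
  jacobian (instantiate P y) z i j =
  jac (lin_coef P y) (tens_coef P) (fun k => z k 0) i j.
Proof.
rewrite mxE instantiate_quad // meval_mderiv_quad_mpoly // => k l.
exact: tens_coefC.
Qed.

Lemma const_coef_ge0 y i : vle 0 y -> 0 <= const_coef P y i.
Proof.
move=> y0; have y_ge0 b : 0 <= y b 0 by have := y0 b; rewrite mxE.
rewrite !addr_ge0 // sumr_ge0 // => b _; first by rewrite mulr_ge0.
by apply: sumr_ge0 => c _; rewrite -mulrA mulr_ge0 ?quad_coef_ge0 ?mulr_ge0.
Qed.

Lemma lin_coef_ge0 y i j : vle 0 y -> 0 <= lin_coef P y i j.
Proof.
move=> y0; have y_ge0 b : 0 <= y b 0 by have := y0 b; rewrite mxE.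
rewrite addr_ge0 // mulr_ge0 // sumr_ge0 // => b _.
by rewrite mulr_ge0 // quad_coef_ge0.
Qed.

Lemma le_const_coef y y' i : vle 0 y -> vle y y' ->
  const_coef P y i <= const_coef P y' i.
Proof.
move=> y0 yy; have y_ge0 b : 0 <= y b 0 by have := y0 b; rewrite mxE.
rewrite !lerD // ler_sum // => b _; first by rewrite ler_wpM2l.
apply: ler_sum => c _; rewrite -[leLHS]mulrA -[leRHS]mulrA ler_wpM2l ?quad_coef_ge0 //.
by rewrite ler_pM.
Qed.

Lemma le_lin_coef y y' i j : vle y y' -> lin_coef P y i j <= lin_coef P y' i j.
Proof.
move=> yy; rewrite lerD // ler_pM2l //; apply: ler_sum => b _.
by rewrite ler_wpM2l // quad_coef_ge0.
Qed.

Lemma instantiate_mps y : vle 0 y -> is_mps (instantiate P y).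
Proof.
move=> y0 i mu; rewrite instantiate_quad // mcoeff_quad_mpoly.
rewrite !addr_ge0 // ?mulr_ge0 ?const_coef_ge0 // sumr_ge0 // => j _.
  by rewrite mulr_ge0 // lin_coef_ge0.
by apply: sumr_ge0 => k _; rewrite mulr_ge0 // tens_coef_ge0.
Qed.

Lemma dependency_instantiate y i j : vle 0 y -> dependency (instantiate P y) i j ->
  0 < lin_coef P y i j \/ exists k, 0 < tens_coef P i j k.
Proof.
move=> y0 /hasP[mu _ /andP[]]; rewrite instantiate_quad // mcoeff_quad_mpoly.
move=> c_gt0 muj.
have L0 := lin_coef_ge0 i j y0.
case: (ltrP 0 (lin_coef P y i j)) => [|Lj]; first by left.
right; case: (pickP (fun k => 0 < tens_coef P i j k)) => [k Tk|T0].
  by exists k.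
have Lij : lin_coef P y i j = 0 by apply/eqP; rewrite eq_le Lj.
have Tij k : tens_coef P i j k = 0.
  by apply/eqP; rewrite eq_le tens_coef_ge0 andbT leNgt T0.
move: c_gt0; rewrite !big1 ?addr0.
- case: eqP => [mu0|_]; last by rewrite mulr0 ltxx.
  by move: muj; rewrite mu0 mnm0E.
- move=> k _; rewrite big1 // => l _; case: eqP => [e|]; rewrite ?mulr0 //.
  move: muj; rewrite -e mnmDE !mnm1E.
  case: (eqVneq k j) => [->|_]; first by rewrite Tij mul0r.
  by case: (eqVneq l j) => [->|//]; rewrite tens_coefC Tij mul0r.
- move=> k _; case: eqP => [e|]; rewrite ?mulr0 //.
  move: muj; rewrite -e mnm1E.
  by case: (eqVneq k j) => [->|//]; rewrite Lij mul0r.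
Qed.

Lemma degree1_tens_coef y i j k : vle 0 y -> degree_le (instantiate P y) 1 ->
  tens_coef P i j k = 0.
Proof.
move=> y0 deg1; set mu := (U_(j) + U_(k))%MM.
have : (instantiate P y i)@_mu = 0.
  apply/eqP; rewrite mcoeff_eq0; apply: msize_mdeg_ge.
  by rewrite mdegD !mdeg1; apply: deg1.
rewrite instantiate_quad // mcoeff_quad_mpoly => e.
have h1 : 0 <= const_coef P y i * (mu == 0%MM)%:R.
  by rewrite mulr_ge0 // const_coef_ge0.
have h2 : 0 <= \sum_j lin_coef P y i j * (U_(j)%MM == mu)%:R.
  by apply: sumr_ge0 => l _; rewrite mulr_ge0 // lin_coef_ge0.
have h3 : tens_coef P i j k <=
    \sum_j \sum_k tens_coef P i j k * ((U_(j) + U_(k))%MM == mu)%:R.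
  rewrite (bigD1 j) //= (bigD1 k) //= eqxx mulr1 -addrA lerDl.
  rewrite addr_ge0 // sumr_ge0 // => l _.
    by rewrite mulr_ge0 // tens_coef_ge0.
  by apply: sumr_ge0 => l' _; rewrite mulr_ge0 // tens_coef_ge0.
by have := tens_coef_ge0 i j k; lra.
Qed.

End InstantiateFacts.

(** * Bounds in terms of alpha *)

Lemma sum_gt0_exists (R : realFieldType) (I : finType) (f : I -> R) :
  0 < \sum_i f i -> exists i, 0 < f i.
Proof.
move=> s0; case: (pickP (fun i => 0 < f i)) => [i fi|f0]; first by exists i.
by move: s0; rewrite ltNge sumr_le0 // => i _; rewrite leNgt f0.
Qed.

Lemma eq_quad (R : realFieldType) n (c : 'I_n -> R) L T x y i : x =1 y ->
  quad c L T x i = quad c L T y i.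
Proof.
move=> xy; rewrite /quad; congr (_ + _ + _); apply: eq_bigr => j _; rewrite xy //.
by congr (_ * _); apply: eq_bigr => k _; rewrite xy.
Qed.

Section LeastFixedPoints.
Variables (R : realType) (n m : nat) (P : 'I_n -> {mpoly R[n + m]}).
Hypotheses (P_deg : degree_le P 2) (P_ge0 : nonneg_coeffs P).
Variable y : 'cV[R]_m.
Hypothesis y_ge0 : vle 0 y.

Let F := quad (const_coef P y) (lin_coef P y) (tens_coef P).

Lemma instantiate_lfp_exists (z : 'I_n -> R) :
  (forall i, 0 <= z i) -> (forall i, F z i <= z i) ->
  exists2 q, is_lfp (instantiate P y) q & forall i, q i 0 <= z i.
Proof.
have c0 i : 0 <= const_coef P y i by apply: const_coef_ge0.
have L0 i j : 0 <= lin_coef P y i j by apply: lin_coef_ge0.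
have T0 i j k : 0 <= tens_coef P i j k by apply: tens_coef_ge0.
move=> z0 Fz; have [||q [q0 Fq q_least]] := knaster_tarski _ _ z0 Fz.
- by move=> x i x0; apply: quad_ge0.
- by move=> x x' i x0 xx; apply: le_quad => // *; apply: tens_coefC.
have qE : (fun j => (\col_k q k : 'cV[R]_n) j 0) =1 q by move=> j; rewrite mxE.
exists (\col_i q i) => [|i]; last by rewrite mxE; apply: q_least.
split=> [i||x x0 Fx i]; first by rewrite !mxE.
  apply/colP => i; rewrite pvec_eval_instantiate // (eq_quad _ _ _ _ qE) mxE.
  exact/esym/Fq.
rewrite mxE; apply: (q_least (fun i => x i 0)) => j.
  by have := x0 j; rewrite mxE.
by rewrite /F -pvec_eval_instantiate // -Fx.
Qed.

Lemma instantiate_lfp_fixed q i :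
  is_lfp (instantiate P y) q -> F (fun j => q j 0) i = q i 0.
Proof. by case=> _ qF _; rewrite /F -pvec_eval_instantiate // -qF. Qed.

(** [is_lfp] compares [q] with fixed points only, but below any post-fixed point [z] there is a
    fixed point. *)
Lemma instantiate_lfp_le_post q z : is_lfp (instantiate P y) q ->
  (forall i, 0 <= z i) -> (forall i, F z i <= z i) -> forall i, q i 0 <= z i.
Proof.
case=> _ _ q_least z0 Fz i.
have [q' [q'0 q'F _] q'z] := instantiate_lfp_exists z0 Fz.
by apply: le_trans (q'z i); apply: q_least.
Qed.

End LeastFixedPoints.

Section AlphaBounds.
Variables (R : realType) (n m : nat) (P : 'I_n -> {mpoly R[n + m]}).
Hypotheses (P_deg : degree_le P 2) (P_ge0 : nonneg_coeffs P).
Variables (y : 'cV[R]_m) (q : 'cV[R]_n) (i0 : 'I_n) (b0 : 'I_m).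
Hypotheses (y_gt0 : vlt 0 y) (q_gt0 : vlt 0 q) (q_le1 : vle q (ones R n)).
Hypothesis q_lfp : is_lfp (instantiate P y) q.

Let y_pos b : 0 < y b 0.
Proof. by have := y_gt0 b; rewrite mxE. Qed.

Let q_pos i : 0 < q i 0.
Proof. by have := q_gt0 i; rewrite mxE. Qed.

Let y_ge0 : vle 0 y.
Proof. by move=> b; rewrite mxE ltW. Qed.

Let kappa := Num.min 1 (coeff_min P).
Let mu := Num.min (vec_min y) (2^-1 * vec_min q).
Let a := alpha P y q.

(** A nonzero coefficient exists because [P i0] takes the positive value [q i0 0]; its leading
    coefficient is one. *)
Let kappa_gt0 : 0 < kappa.
Proof.
rewrite lt_min ltr01 /=; apply: (coeff_min_gt0 P_ge0 (i := i0) (mu := mlead (P i0))).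
rewrite mleadc_eq0; apply: contraTneq (q_pos i0) => P0.
case: q_lfp => _ -> _; rewrite mxE meval_instantiate P0 meval0.
by rewrite ltxx.
Qed.

Let kappa_le1 : kappa <= 1.
Proof. by rewrite ge_min lexx. Qed.

Let kappa_le : kappa <= coeff_min P.
Proof. by rewrite ge_min lexx orbT. Qed.

Let mu_gt0 : 0 < mu.
Proof.
have [b eb] := vec_min_attained y b0; have [i ei] := vec_min_attained q i0.
by rewrite lt_min eb ei y_pos mulr_gt0 ?invr_gt0.
Qed.

Let mu_y b : mu <= y b 0.
Proof. by rewrite ge_min vec_min_le. Qed.

Let mu_q i : mu <= q i 0 / 2.
Proof. by rewrite ge_min [_ / 2]mulrC ler_pM2l ?invr_gt0 // vec_min_le orbT. Qed.

Let mu_half : mu <= 2^-1.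
Proof.
have := mu_q i0; have := q_le1 i0; rewrite mxE; lra.
Qed.

Let mu_le1 : mu <= 1.
Proof. by apply: le_trans mu_half _; lra. Qed.

Lemma alpha_gt0 : 0 < a.
Proof. exact: mulr_gt0. Qed.

Lemma alpha_le_half : a <= 2^-1.
Proof. by rewrite -[leRHS]mul1r ler_pM // ltW. Qed.

Lemma alpha_le_coeff i nu : 0 < (P i)@_nu -> a <= (P i)@_nu.
Proof.
move=> c0; apply: le_trans (coeff_min_le (lt0r_neq0 c0)); apply: le_trans kappa_le.
by rewrite ler_piMr ?(ltW kappa_gt0).
Qed.

Lemma alpha_le_quad i j k : 0 < quad_coef (P i) j k -> a <= 2 * quad_coef (P i) j k.
Proof.
move=> c0; apply: le_trans (coeff_min_quad_le P_ge0 c0); apply: le_trans kappa_le.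
by rewrite ler_piMr ?(ltW kappa_gt0).
Qed.

(** An edge stems from a monomial x_j, x_j y_b or x_j x_k. Its contribution is at least a
    coefficient times at most one factor, an entry of [y] or of [q / 2]. *)
Lemma alpha_le_jac i j : dependency (instantiate P y) i j ->
  a <= jac (lin_coef P y) (tens_coef P) (fun k => q k 0 / 2) i j.
Proof.
have q0 k : 0 <= q k 0 / 2 by rewrite divr_ge0 // ltW.
have h0 : 0 <= (P i)@_U_(lshift m j) by apply: P_ge0.
have S0 b : 0 <= quad_coef (P i) (lshift m j) (rshift n b) * y b 0.
  by rewrite mulr_ge0 ?quad_coef_ge0 // ltW.
have T0 k : 0 <= tens_coef P i j k * (q k 0 / 2).
  by rewrite mulr_ge0 // tens_coef_ge0.
have h1 : 0 <= \sum_b quad_coef (P i) (lshift m j) (rshift n b) * y b 0.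
  exact: sumr_ge0.
have h2 : 0 <= tmat (tens_coef P) (fun k => q k 0 / 2) i j by apply: sumr_ge0.
case/(dependency_instantiate P_deg P_ge0 y_ge0) => [|[k Tk]]; rewrite /jac.
  rewrite {1}/lin_coef => Lpos; rewrite /lin_coef.
  case: (ltrP 0 ((P i)@_U_(lshift m j))) => [/alpha_le_coeff|c0]; first by lra.
  have [|b] := @sum_gt0_exists _ _ (fun b =>
    quad_coef (P i) (lshift m j) (rshift n b) * y b 0); first by lra.
  rewrite pmulr_lgt0 // => qb.
  have hb : a <= 2 * (quad_coef (P i) (lshift m j) (rshift n b) * y b 0).
    rewrite mulrA ler_pM ?(ltW kappa_gt0) ?(ltW mu_gt0) //.
    exact: le_trans kappa_le (coeff_min_quad_le P_ge0 qb).
  have hs : quad_coef (P i) (lshift m j) (rshift n b) * y b 0 <=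
      \sum_b quad_coef (P i) (lshift m j) (rshift n b) * y b 0.
    by rewrite [leRHS](bigD1 b) //= lerDl sumr_ge0.
  by lra.
have hk : a <= 2 * (tens_coef P i j k * (q k 0 / 2)).
  rewrite mulrA ler_pM ?(ltW kappa_gt0) ?(ltW mu_gt0) //.
  exact: le_trans kappa_le (coeff_min_quad_le P_ge0 Tk).
have := lin_coef_ge0 P_ge0 i j y_ge0.
have : tens_coef P i j k * (q k 0 / 2) <= tmat (tens_coef P) (fun k => q k 0 / 2) i j.
  by rewrite /tmat [leRHS](bigD1 k) //= lerDl sumr_ge0.
by lra.
Qed.

(** The square is due to monomials y_b y_c, which carry two entries of [y]; the factor 2 is due to
    the halved mixed coefficients. *)
Lemma alpha_le_const i : 0 < const_coef P y i -> a ^+ 2 <= 2 * const_coef P y i.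
Proof.
have a2 : a ^+ 2 <= a.
  by rewrite expr2 ler_piMr ?(ltW alpha_gt0) //; have := alpha_le_half; lra.
have a0 := alpha_gt0.
have h0 : 0 <= (P i)@_0 by apply: P_ge0.
have L0 b : 0 <= (P i)@_U_(rshift n b) * y b 0 by rewrite mulr_ge0 // ltW.
have T0 b c : 0 <= quad_coef (P i) (rshift n b) (rshift n c) * y b 0 * y c 0.
  by rewrite -mulrA mulr_ge0 ?quad_coef_ge0 // mulr_ge0 // ltW.
have T0' b : 0 <= \sum_c quad_coef (P i) (rshift n b) (rshift n c) * y b 0 * y c 0.
  exact: sumr_ge0.
have h1 : 0 <= \sum_b (P i)@_U_(rshift n b) * y b 0 by apply: sumr_ge0.
have h2 : 0 <=
    \sum_b \sum_c quad_coef (P i) (rshift n b) (rshift n c) * y b 0 * y c 0.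
  exact: sumr_ge0.
rewrite /const_coef => pos.
case: (ltrP 0 ((P i)@_0)) => [/alpha_le_coeff|c0]; first by lra.
case: (ltrP 0 (\sum_b (P i)@_U_(rshift n b) * y b 0)) => [s0|s0].
  have [b] := sum_gt0_exists s0; rewrite pmulr_lgt0 // => cb.
  have hb : a <= (P i)@_U_(rshift n b) * y b 0.
    rewrite ler_pM ?(ltW kappa_gt0) ?(ltW mu_gt0) //.
    exact: le_trans kappa_le (coeff_min_le (lt0r_neq0 cb)).
  have hs : (P i)@_U_(rshift n b) * y b 0 <= \sum_b (P i)@_U_(rshift n b) * y b 0.
    by rewrite [leRHS](bigD1 b) //= lerDl sumr_ge0.
  by lra.
have s1 : 0 < \sum_b \sum_c quad_coef (P i) (rshift n b) (rshift n c) * y b 0 * y c 0.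
  by lra.
have [b sb] := sum_gt0_exists s1; have [c] := sum_gt0_exists sb.
rewrite pmulr_lgt0 // pmulr_lgt0 // => cb.
have hb : a ^+ 2 <= 2 * (quad_coef (P i) (rshift n b) (rshift n c) * y b 0 * y c 0).
  have -> : a ^+ 2 = kappa * kappa * (mu * mu) by rewrite /a /alpha -/kappa -/mu; ring.
  rewrite -[X in _ <= 2 * X]mulrA [leRHS]mulrA.
  rewrite ler_pM ?mulr_ge0 ?(ltW kappa_gt0) ?(ltW mu_gt0) //.
    apply: (@le_trans _ _ kappa).
      by rewrite ler_piMr // ltW.
    exact: le_trans kappa_le (coeff_min_quad_le P_ge0 cb).
  by rewrite ler_pM ?(ltW mu_gt0).
have hs : quad_coef (P i) (rshift n b) (rshift n c) * y b 0 * y c 0 <=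
    \sum_b \sum_c quad_coef (P i) (rshift n b) (rshift n c) * y b 0 * y c 0.
  rewrite [leRHS](bigD1 b) //= [X in _ <= X + _](bigD1 c) //= -addrA lerDl.
  by rewrite addr_ge0 // sumr_ge0.
by lra.
Qed.

End AlphaBounds.

(** Exponentiating the condition on [h] turns its summand 2 into the factor 4. *)
Lemma rounding_parameter_bound (R : realType) (n h : nat) (a eps : R) :
  0 < a -> 0 < eps ->
  (Num.ceil (2 + n%:R * log2 (1 / a) + log2 (1 / eps)) <= h%:Z)%R ->
  4 * 2 ^- h / a ^+ n <= eps.
Proof.
move=> a0 eps0 hh.
have l2 : 0 < exp.ln 2 :> R by rewrite exp.ln_gt0 // ltr1n.
have : 2 + n%:R * log2 (1 / a) + log2 (1 / eps) <= h%:R.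
  apply: le_trans (ceil_ge _) _; rewrite -[h%:R]/(h%:Z%:~R) ler_int; exact: hh.
rewrite /log2 !div1r -(ler_pM2r l2) => le_h.
have aV : 0 < a^-1 by rewrite invr_gt0.
have epsV : 0 < eps^-1 by rewrite invr_gt0.
have le_2h : 4 * a^-1 ^+ n * eps^-1 <= 2 ^+ h.
  rewrite -exp.ler_ln ?posrE ?mulr_gt0 ?exprn_gt0 //.
  have -> : 4 = 2 ^+ 2 :> R by ring.
  rewrite !exp.lnM ?posrE ?mulr_gt0 ?exprn_gt0 // !exp.lnXn //.
  rewrite -[exp.ln 2 *+ h]mulr_natl -[exp.ln a^-1 *+ n]mulr_natl.
  apply: le_trans le_h; rewrite le_eqVlt; apply/orP; left.
  by apply/eqP; field; rewrite gt_eqF.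
rewrite ler_pdivrMr ?exprn_gt0 // ler_pdivrMr ?exprn_gt0 //.
move: le_2h; rewrite ler_pdivrMr // exprVn ler_pdivrMr ?exprn_gt0 //.
by congr (_ <= _); ring.
Qed.

(** * Assembly of the perturbation and rounding bounds *)

Theorem theorem2 (R : realType) (n m : nat) (hn : (1 <= n)%N) (hm : (1 <= m)%N)
    (P : 'I_n -> {mpoly R[n + m]})
    (P_deg : degree_le P 2) (P_ge0 : nonneg_coeffs P)
    (y1 y2 : 'cV[R]_m)
    (y1_gt0 : vlt 0 y1) (y1_le1 : vle y1 (ones R m))
    (y2_ge0 : vle 0 y2) (y2_le : vle y2 y1)
    (P1_mps : is_mps (instantiate P y1))
    (P1_sc : strongly_connected (instantiate P y1))
    (q1 : 'cV[R]_n) (q1_lfp : is_lfp (instantiate P y1) q1)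
    (q1_gt0 : vlt 0 q1) (q1_le1 : vle q1 (ones R n)) :
  let P1 := instantiate P y1 in
  let P2 := instantiate P y2 in
  let a := alpha P y1 q1 in
  let normP11 := norm_inf (pvec_eval P (col_mx (ones R n) (ones R m))) in
  is_mps P2 /\
  exists q2 : 'cV[R]_n,
    [/\ is_lfp P2 q2,
        vle 0 q2 /\ vle q2 q1,
        norm_inf (q1 - q2) <=
          Num.sqrt (4 * n%:R * a ^- (3 * n + 1) * normP11 * norm_inf (y1 - y2)),
        degree_le P1 1 ->
          norm_inf (q1 - q2) <=
            2 * n%:R * a ^- (n + 2) * normP11 * norm_inf (y1 - y2)
      & forall (eps : R) (h g : nat), 0 < eps < 1 ->
          (Num.ceil (2 + n%:R * log2 (1 / a) + log2 (1 / eps)) <= h%:Z)%R ->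
          (h - 1 <= g)%N ->
          exists2 x : 'cV[R]_n, rnm P2 h g = Some x & norm_inf (q2 - x) <= eps].
Proof.
move=> P1 P2 a normP11; pose i0 : 'I_n := Ordinal hn; pose b0 : 'I_m := Ordinal hm.
have y1_ge0 : vle 0 y1 by move=> b; apply: ltW.
pose c1 := const_coef P y1; pose c2 := const_coef P y2.
pose L1 := lin_coef P y1; pose L2 := lin_coef P y2; pose T := tens_coef P.
pose q1f i := q1 i 0.
have c1_ge0 i : 0 <= c1 i by apply: const_coef_ge0.
have c2_le i : c2 i <= c1 i by apply: le_const_coef.
have L1_ge0 i j : 0 <= L1 i j by apply: lin_coef_ge0.
have L2_ge0 i j : 0 <= L2 i j by apply: lin_coef_ge0.
have L2_le i j : L2 i j <= L1 i j by apply: le_lin_coef.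
have T_ge0 i j k : 0 <= T i j k by apply: tens_coef_ge0.
have T_sym i j k : T i j k = T i k j by apply: tens_coefC.
have q1_pos i : 0 < q1f i by have := q1_gt0 i; rewrite mxE.
have q1_one i : q1f i <= 1 by have := q1_le1 i; rewrite mxE.
have q1_fix i : quad c1 L1 T q1f i = q1f i by apply: instantiate_lfp_fixed.
have q1_least := instantiate_lfp_le_post P_deg P_ge0 y1_ge0 q1_lfp.
have a_gt0 : 0 < a by apply: alpha_gt0.
have a_half : a <= 2^-1 by apply: alpha_le_half.
have a_le1 : a <= 1 by lra.
have E_jac i j : dependency P1 i j -> a <= jac L1 T (fun k => q1f k / 2) i j.
  exact: alpha_le_jac.
(* [q1] is a post-fixed point of the perturbed system, which gives both the existence of [q2] and
   [q2 <= q1]. *)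
have q1_post i : quad c2 L2 T q1f i <= q1f i.
  rewrite -[leRHS]q1_fix /quad lerD2r lerD //.
  by apply: le_mvl => // j; apply: ltW.
have [q2 q2_lfp q2_le] := instantiate_lfp_exists P_deg P_ge0 y2_ge0
  (fun i => ltW (q1_pos i)) q1_post.
pose q2f i := q2 i 0.
have q2f_ge0 i : 0 <= q2f i by case: q2_lfp => /(_ i); rewrite mxE.
have q2_fix i : quad c2 L2 T q2f i = q2f i by apply: instantiate_lfp_fixed.
split; first exact: instantiate_mps.
pose D := norm_inf (y1 - y2); pose e := 2 * D * normP11.
have D_ge0 : 0 <= D by apply: le_trans (norm_inf_ge _ b0).
have N_ge0 : 0 <= normP11 by apply: le_trans (norm_inf_ge _ i0).
have e_ge0 : 0 <= e by rewrite !mulr_ge0.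
have gap_le i : quad c1 L1 T q2f i - quad c2 L2 T q2f i <= e.
  have quadE y : quad (const_coef P y) (lin_coef P y) T q2f i =
      (P i).@[fun v => col_mx q2 y v 0].
    by rewrite -meval_instantiate -pvec_eval_instantiate // mxE.
  rewrite !quadE; apply: (@le_trans _ _ (2 * D * (P i).@[fun=> 1])).
    apply: meval_quad_gap => // v.
    - case: (splitP v) => k kv.
        have -> : v = lshift m k by apply: val_inj.
        by rewrite !col_mxEu lexx andbT; apply: q2f_ge0.
      have -> : v = rshift n k by apply: val_inj.
      by rewrite !col_mxEd y2_le andbT; have := y2_ge0 k; rewrite [X in X <= _]mxE.
    - case: (splitP v) => k kv.
        have -> : v = lshift m k by apply: val_inj.
        by rewrite col_mxEu; apply: le_trans (q2_le k) (q1_one k).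
      have -> : v = rshift n k by apply: val_inj.
      by rewrite col_mxEd; have := y1_le1 k; rewrite mxE.
    - case: (splitP v) => k kv.
        have -> : v = lshift m k by apply: val_inj.
        by rewrite !col_mxEu subrr.
      have -> : v = rshift n k by apply: val_inj.
      rewrite !col_mxEd; apply: le_trans (norm_inf_ge _ k).
      by rewrite !mxE ler_norm.
  rewrite ler_wpM2l ?mulr_ge0 //; apply: le_trans (norm_inf_ge _ i).
  rewrite mxE; apply: le_trans (ler_norm _).
  rewrite le_eqVlt; apply/orP; left; apply/eqP; apply: meval_eq => v.
  by case: (splitP v) => k kv; rewrite mxE; case: splitP => ? _; rewrite mxE.
have d_ge0 i : 0 <= q1f i - q2f i by rewrite subr_ge0; apply: q2_le.
have d_le1 i : q1f i - q2f i <= 1 by have := q1_one i; have := q2f_ge0 i; lra.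
have normE b : 0 <= b -> (forall i, q1f i - q2f i <= b) -> norm_inf (q1 - q2) <= b.
  move=> b_ge0 le_b; apply: norm_inf_le => // i.
  by rewrite !mxE -/(q1f i) -/(q2f i) ger0_norm.
(* The exponent n + 2 collects n - 1 from the ratios, 2 from the constant term, and one more
   [a <= 1/2] that cancels the 2 of [alpha_le_const]. *)
have linear_bound : (forall i j k, T i j k = 0) -> forall i,
    a ^+ (n + 2) * (q1f i - q2f i) <= n%:R * e.
  move=> T0 i; have [k ck] := lfp_const_gt0 i0 q1_pos q1_least.
  have := lfp_gap_linear i0 c1_ge0 L1_ge0 T_ge0 T_sym q1_pos q1_fix q1_least P1_sc
    a_gt0 a_le1 E_jac q2_fix T0 k i e_ge0 q1_one gap_le.
  apply: le_trans; rewrite ler_wpM2r //.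
  have ck2 : a ^+ 2 <= 2 * c1 k.
    exact: (alpha_le_const P_ge0 i0 b0 y1_gt0 q1_gt0 q1_le1 q1_lfp ck).
  have -> : a ^+ (n + 2) = (a * a ^+ 2) * a ^+ n.-1.
    by rewrite -exprS -exprD; congr (_ ^+ _); lia.
  rewrite ler_wpM2r ?exprn_ge0 ?(ltW a_gt0) //.
  have : a * a ^+ 2 <= 2^-1 * a ^+ 2 by rewrite ler_wpM2r // exprn_ge0 // ltW.
  by lra.
exists q2; split=> //.
- by split=> i; [rewrite mxE; apply: q2f_ge0|apply: q2_le].
- set X := 4 * _ * _ * _ * _; have X_ge0 : 0 <= X.
    by rewrite !mulr_ge0 // invr_ge0 exprn_ge0 // ltW.
  apply: normE => [|i]; first exact: sqrtr_ge0.
  rewrite -[leLHS]ger0_norm // -sqrtr_sqr ler_wsqrtr //.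
  have -> : X = 2 * (n%:R * e) / a ^+ (3 * n + 1) by rewrite /X /e /D; ring.
  rewrite ler_pdivlMr ?exprn_gt0 //.
  have ne : 0 <= n%:R * e by rewrite mulr_ge0.
  (* If [T] vanishes, the linear bound suffices: the gap is at most 1, so it dominates its square,
     and n + 2 <= 3n + 1. Otherwise a nonzero entry of [T], at least [a / 2], feeds the quadratic
     bound. *)
  have [T0|[j [k [l Tjkl]]]] := linear_or_nonlinear T_ge0.
    apply: (@le_trans _ _ (a ^+ (n + 2) * (q1f i - q2f i))).
      rewrite mulrC ler_pM ?exprn_ge0 ?(ltW a_gt0) //.
        by rewrite ler_wiXn2l ?(ltW a_gt0) //; lia.
      by rewrite expr2 ler_piMr.
    by have := linear_bound T0 i; lra.
  have := lfp_gap_quadratic i0 L1_ge0 T_ge0 T_sym q1_pos q1_fix q1_least P1_sc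
    a_gt0 a_le1 E_jac c2_le L2_le q2f_ge0 q2_le q2_fix j k l i e_ge0 gap_le.
  have aT : a <= 2 * T j k l by apply: alpha_le_quad Tjkl.
  rewrite -(ler_pM2l (ltr0n R 2)); apply: le_trans.
  rewrite [leRHS](_ : _ = 2 * T j k l * (a ^+ n.-1) ^+ 3 * (q1f i - q2f i) ^+ 2).
    rewrite mulrC ler_wpM2r ?sqr_ge0 //.
    apply: (@le_trans _ _ (a * (a ^+ n.-1) ^+ 3)).
      by rewrite -exprM -exprS ler_wiXn2l ?(ltW a_gt0) //; lia.
    by rewrite ler_wpM2r // !exprn_ge0 // ltW.
  by ring.
- move=> deg1; have T0 i j k : T i j k = 0 by apply: degree1_tens_coef deg1.
  set X := 2 * _ * _ * _ * _.
  have -> : X = n%:R * e / a ^+ (n + 2) by rewrite /X /e /D; ring.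
  apply: normE => [|i].
    by rewrite divr_ge0 ?mulr_ge0 // exprn_ge0 // ltW.
  by rewrite ler_pdivlMr ?exprn_gt0 // mulrC linear_bound.
move=> eps h g /andP[eps0 _] hh gh.
have [x rx x_gap] := rnm_error i0 c1_ge0 L1_ge0 T_ge0 T_sym q1_pos q1_fix q1_least
  P1_sc a_gt0 a_le1 E_jac c2_le L2_ge0 L2_le q2f_ge0 q2_le q2_fix
  (pvec_eval_instantiate P_deg y2) (jacobian_instantiate P_deg y2) h g q1_one.
exists x => //; apply: norm_inf_le => [|i]; first exact: ltW.
have /andP[x0 x_le] := x_gap i; rewrite !mxE ger0_norm //.
apply: le_trans x_le _; apply: le_trans (rounding_parameter_bound a_gt0 eps0 hh).
have an0 k : 0 < a ^+ k by rewrite exprn_gt0.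
have h0 : 0 < 2 ^+ h :> R by rewrite exprn_gt0.
have hV : 0 < 2 ^- h :> R by rewrite invr_gt0.
rewrite ler_pM ?invr_ge0 ?(ltW (an0 _)) //.
- by rewrite addr_ge0 ?mulr_ge0 ?invr_ge0 ?exprn_ge0 // ltW.
(* This is where [g >= h - 1] is used: the halving error is then at most the accumulated rounding
   error, and both together make [4 * 2 ^- h]. *)
- have : 2 ^- g <= 2 * 2 ^- h :> R; last by lra.
  have -> : 2 * 2 ^- h = (2 ^+ h / 2)^-1 :> R by field; rewrite gt_eqF.
  rewrite lef_pV2 ?posrE ?divr_gt0 ?exprn_gt0 // ler_pdivrMr // -exprSr.
  by rewrite ler_weXn2l ?ler1n //; lia.
- rewrite lef_pV2 ?posrE // ler_wiXn2l ?(ltW a_gt0) //; lia.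
Qed.
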